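(* Let $\mathcal T$ be an operadic expression tree category, and let $\widehat{\mathcal T}$ be obtained from it by adjoining a strict initial object $0$. The form $\mathsf G$ of marked prunings on $\widehat{\mathcal T}$ is noetherian and has exact join decomposition. Its universal quotients are the maps of $\mathcal E$, and its universal embeddings are the maps of $\mathcal M$.
   Context: EXPRESSION TREE CATEGORIES. A ranked set is a set $L$ with a function $\operatorname{ar}:L\to\mathbb N$. Trees over $L$: the empty leaf $1$ is a tree, and for $\lambda\in L$, $n=\operatorname{ar}(\lambda)$ and trees $T_1,\dots,T_n$ there is a tree $\lambda(T_1,\dots,T_n)$; equality is syntactic. Positions: $\operatorname{Pos}(1)=\{()\}$, and $\operatorname{Pos}(\lambda(T_1,\dots,T_n))$ consists of the empty word and the words $pb$ with $1\le p\le n$, $b\in\operatorname{Pos}(T_p)$; $X|_a$ is the entire subtree at $a$. An occurrence $A\to X$ is a position $a$ with $X|_a=A$; occurrences compose by concatenating addresses. $T$ is obtainable from $X$ by pruning if $T=1$, or $X=\lambda(X_1,\dots,X_n)$ and $T=\lambda(T_1,\dots,T_n)$ with each $T_p$ obtainable from $X_p$; then there is exactly one pruning map $d:X\to T$ (otherwise none), $\operatorname{Pos}(T)\subseteq\operatorname{Pos}(X)$, and $p_d$ sends a position of $X$ to its longest prefix in $\operatorname{Pos}(T)$. The category $\mathcal C_L$ has trees as objects; a morphism $X\to Y$ (prefix–suffix matching) is a pair $(d,u)$ of a pruning map $d:X\to T$ and an occurrence $u:T\to Y$. For $(d,u):X\to Y$ with $u$ at address $a$ and $(e,v):Y\to Z$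 with $e:Y\to S$, the composite is $(e_ad,vu')$, where $u'$ is the occurrence of $S|_{p_e(a)}$ in $S$ at $p_e(a)$ and $e_a:Y|_a\to S|_{p_e(a)}$ is the pruning map. Identities are the pairs of identities. Prunings and occurrences are regarded as the matchings whose other component is an identity. An operadic expression tree category is a category isomorphic to some $\mathcal C_L$, with the corresponding prunings and occurrences. AUGMENTATION AND CLUSTERS. $\widehat{\mathcal T}$ is $\mathcal T$ with a new object $0$, a unique morphism $0\to X$ for every object $X$ (including $0$), and no morphism from an object of $\mathcal T$ to $0$. $\mathcal E$ consists of the prunings of $\mathcal T$ together with $\mathrm{id}_0$; $\mathcal M$ consists of the occurrences of $\mathcal T$ together with all morphisms $0\to X$. A cluster over $X$ is a cospan $X\xrightarrow{q}Q\xleftarrow{u}U$ with $q\in\mathcal E$, $u\in\mathcal M$ and $U\in\{0,1\}$, written $[q,u]$; cospans are identified up to isomorphism fixing $X$. For clusters $[q,u]$ over $X$ and $[r,v]$ over $Y$ ($r:Y\to R$, $v:V\to R$) and $f:X\to Y$, write $[q,u]\le_f[r,v]$ when there are $h:Q\to R$ and $k:U\to V$ with $hq=rf$ and $hu=vk$. The clusters with these comparisons form $\mathsf G$. FORMS. A form $\mathsf F$ over a category $\mathcal C$ is a faithful functor to $\mathcal C$, described by its sets $\mathsf F(X)$ of clusters over objects $X$ (fibres) and its comparison relations $L\le_fN$ ($f:X\to Y$, $L\in\mathsf F(X)$, $N\in\mathsf F(Y)$), with $L\le_{\mathrm{id}}L$, and $L\le_fM$, $M\le_gN$ implying $L\le_{gf}N$;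 $\mathsf F(X)$ is ordered by $\le_{\mathrm{id}_X}$, a partial order. It is orean when each fibre is a bounded lattice and every $f:X\to Y$ has functorial direct and inverse images $f_*:\mathsf F(X)\to\mathsf F(Y)$, $f^*:\mathsf F(Y)\to\mathsf F(X)$ with $f_*L\le N\iff L\le_fN\iff L\le f^*N$. Put $\operatorname{Ker}f=f^*(\bot)$, $\operatorname{Im}f=f_*(\top)$. A cluster over $X$ is normal if it is the kernel of a morphism with domain $X$ and conormal if it is the image of a morphism with codomain $X$. A universal quotient of a cluster $L$ over $X$ is $q:X\to Q$ with $L\le\operatorname{Ker}q$ through which every $f:X\to Y$ with $L\le\operatorname{Ker}f$ factors uniquely. A universal embedding of a cluster $N$ over $Y$ is $m:A\to Y$ with $\operatorname{Im}m\le N$ through which every $f:X\to Y$ with $\operatorname{Im}f\le N$ factors uniquely. The universal quotients (embeddings) of the form are the morphisms that are a universal quotient (embedding) of some cluster. An orean form is noetherian when: (1) $f^*f_*L=L\vee\operatorname{Ker}f$ and $f_*f^*N=N\wedge\operatorname{Im}f$ for all $f:X\to Y$, $L\in\mathsf F(X)$, $N\in\mathsf F(Y)$; (2) every morphism factors as a universal quotient of its kernel followed by a universal embedding of its image; (3) binary joins of normal clusters are normal and binary meets of conormal clusters are conormal. It has exact join decomposition if every cluster $L$ has a largest normal cluster $n(L)\le L$ and a largest conormal cluster $c(L)\le L$, and $L=c(L)\vee n(L)$, $f^*n(N)=n(f^*N)$, $f_*n(\top)=n(\operatorname{Im}f)$ for all $L$, all $f:X\to Y$ and all $N\in\mathsf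 F(Y)$. *)

(* Defs.v *)
From HB Require Import structures.
From mathcomp Require Import all_boot.
From mathcomp Require Import boolp.

Set Implicit Arguments.
Unset Strict Implicit.
Unset Printing Implicit Defensive.

Record category := Category {
  Ob :> Type;
  hom : Ob -> Ob -> Type;
  idm : forall X, hom X X;
  comp : forall X Y Z, hom Y Z -> hom X Y -> hom X Z;
  comp1m : forall X Y (f : hom X Y), comp (idm Y) f = f;
  compm1 : forall X Y (f : hom X Y), comp f (idm X) = f;
  compA : forall X Y Z W (h : hom Z W) (g : hom Y Z) (f : hom X Y),
      comp h (comp g f) = comp (comp h g) f
}.

Arguments hom {c} X Y.
Arguments idm {c} X.
Arguments comp {c X Y Z} g f.

Notation "g ∘ f" := (comp g f) (at level 40, left associativity).

Definition isomorphism (C : category) (X Y : C) (f : hom X Y) : Prop :=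
  exists g : hom Y X, g ∘ f = idm X /\ f ∘ g = idm Y.

Record functor (C D : category) := Functor {
  fobj :> C -> D;
  fmap : forall X Y, hom X Y -> hom (fobj X) (fobj Y);
  fmap_id : forall X, fmap (idm X) = idm (fobj X);
  fmap_comp : forall X Y Z (g : hom Y Z) (f : hom X Y),
      fmap (g ∘ f) = fmap g ∘ fmap f
}.

Arguments fmap {C D} _ {X Y} _.

Record cat_iso (C D : category) := CatIso {
  iso_functor :> functor C D;
  iso_obj_bij : bijective iso_functor;
  iso_hom_bij : forall X Y : C, bijective (@fmap C D iso_functor X Y)
}.

Section Trees.
Variables (L : Type) (ar : L -> nat).

(* Children are a finite function, so that Leibniz equality of trees is
   syntactic equality. *)
Inductive tree : Type :=
  | leaf
  | node (l : L) (f : {ffun 'I_(ar l) -> tree}).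

(* The subtree at address [a], or [None] if [a] is not a position of [X].
   The children of a node of arity n are numbered 0, ..., n - 1. *)
Fixpoint subtree (X : tree) (a : seq nat) {struct a} : option tree :=
  match a, X with
  | [::], _ => Some X
  | _ :: _, leaf => None
  | p :: b, node l f =>
      if (insub p : option 'I_(ar l)) is Some i then subtree (f i) b else None
  end.

Definition position (X : tree) (a : seq nat) : bool := subtree X a.

Record occurrence (A X : tree) := Occurrence {
  addr : seq nat;
  addrP : subtree X addr = Some A
}.

(* [prunes X T]: T is obtainable from X by pruning.  As the pruning map X -> T
   is then unique, proofs of [prunes X T] serve as the pruning maps. *)
Inductive prunes : tree -> tree -> Prop :=
  | prunes_leaf X : prunes X leaf
  | prunes_node l (f g : {ffun 'I_(ar l) -> tree}) :
      (forall i, prunes (f i) (g i)) -> prunes (node f) (node g).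

(* [clip T a] is the longest prefix of [a] that is a position of [T]; see
   [clip_prefix], [clip_position] and [clip_longest]. *)
Fixpoint clip (T : tree) (a : seq nat) {struct a} : seq nat :=
  match a, T with
  | p :: b, node l f =>
      if (insub p : option 'I_(ar l)) is Some i then p :: clip (f i) b else [::]
  | _, _ => [::]
  end.

Lemma clip_prefix T a : prefix (clip T a) a.
Proof.
elim: a T => [|p b IH] [|l f] //=.
by case: insub => [i|] //=; rewrite eqxx IH.
Qed.

Lemma clip_position T a : position T (clip T a).
Proof.
rewrite /position; elim: a T => [|p b IH] [|l f] //=.
by case E: insub => [i|] //=; rewrite E IH.
Qed.

Lemma clip_longest T a b : prefix b a -> position T b -> prefix b (clip T a).
Proof.
rewrite /position; elim: b a T => [|q b IH] [|p a] [|l f] //=; try by case: eqP.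
  by rewrite prefix0s.
case/andP=> /eqP -> pre; case E: insub => [i|] //= pos.
by rewrite eqxx IH.
Qed.

Lemma subtree_cat X a b :
  subtree X (a ++ b) = obind (fun Y => subtree Y b) (subtree X a).
Proof.
by elim: a X => [|p a IH] [|l f] //=; case: insub => [i|] //=.
Qed.

Fixpoint tree_ind_children (P : tree -> Prop) (Pleaf : P leaf)
    (Pnode : forall l (f : {ffun 'I_(ar l) -> tree}),
       (forall i, P (f i)) -> P (node f)) (X : tree) : P X :=
  match X with
  | leaf => Pleaf
  | node l f => Pnode l f (fun i => tree_ind_children Pleaf Pnode (f i))
  end.

Lemma prunes_refl X : prunes X X.
Proof. by elim/tree_ind_children: X => [|l f IH]; constructor. Qed.

Lemma prunes_inv X l (g : {ffun 'I_(ar l) -> tree}) : prunes X (node g) ->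
  exists2 f : {ffun 'I_(ar l) -> tree}, X = node f & forall i, prunes (f i) (g i).
Proof.
move=> H; inversion H as [|l' f g' Hfg e1 [e2 e3]]; subst.
by exists f.
Qed.

Lemma prunes_trans Y X Z : prunes X Y -> prunes Y Z -> prunes X Z.
Proof.
elim/tree_ind_children: Z X Y => [|l h IH] X Y XY YZ; first by constructor.
case: (prunes_inv YZ) => g eY gh; subst Y.
case: (prunes_inv XY) => f eX fg; subst X.
by constructor=> i; apply: IH (fg i) (gh i).
Qed.

Lemma clip_id X a : position X a -> clip X a = a.
Proof.
rewrite /position; elim: a X => [|p a IH] [|l f] //=.
by case E: insub => [i|] //= pos; rewrite IH.
Qed.

(* The entire subtree at [clip S a]; it is a genuine subtree of [S] by
   [subtree_at_clip]. *)
Definition subtree_clip (S : tree) (a : seq nat) : tree :=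
  odflt leaf (subtree S (clip S a)).

Lemma subtree_at_clip S a : subtree S (clip S a) = Some (subtree_clip S a).
Proof.
by rewrite /subtree_clip; have := clip_position S a; rewrite /position; case: subtree.
Qed.

Lemma restrict_pruning Y S A a :
  subtree Y a = Some A -> prunes Y S -> prunes A (subtree_clip S a).
Proof.
rewrite /subtree_clip.
elim: a Y S => [|p a IH] Y [|l g] //= sY; try by move=> _; constructor.
  by case: sY => <-.
move/prunes_inv=> [f eY fg]; subst Y; move: sY => /=.
by case E: insub => [i|] //= sY; rewrite E; apply: IH sY (fg i).
Qed.

Lemma clip_cat Z R a b : position Z a -> prunes Z R ->
  clip R (a ++ b) = clip R a ++ clip (subtree_clip R a) b.
Proof.
rewrite /position /subtree_clip.
elim: a Z R => [|p a IH] Z [|l g] //= sZ; try by case: (b).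
move/prunes_inv=> [f eZ fg]; subst Z; move: sZ => /=.
by case E: insub => [i|] //= sZ; rewrite E (IH _ _ sZ (fg i)).
Qed.

Lemma clip_clip S R a : prunes S R -> clip R (clip S a) = clip R a.
Proof.
elim: a S R => [|p a IH] S [|l g] //=.
  by case: S => [|m f] //=; case: insub.
move/prunes_inv=> [f -> fg] /=.
by case E: insub => [i|] //=; rewrite E (IH _ _ (fg i)).
Qed.

Definition occ_id (X : tree) : occurrence X X := @Occurrence X X [::] erefl.

Lemma occ_comp_subproof X Y Z (v : occurrence Y Z) (u : occurrence X Y) :
  subtree Z (addr v ++ addr u) = Some X.
Proof. by rewrite subtree_cat addrP /= addrP. Qed.

Definition occ_comp X Y Z (v : occurrence Y Z) (u : occurrence X Y) :
  occurrence X Z := Occurrence (occ_comp_subproof v u).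

Definition occ_clip (S : tree) (a : seq nat) : occurrence (subtree_clip S a) S :=
  Occurrence (subtree_at_clip S a).

Record matching (X Y : tree) := Matching {
  m_mid : tree;
  m_prune : prunes X m_mid;
  m_occ : occurrence m_mid Y
}.

Definition matching_of_pruning X Y (d : prunes X Y) : matching X Y :=
  Matching d (occ_id Y).

Definition matching_of_occurrence X Y (u : occurrence X Y) : matching X Y :=
  Matching (prunes_refl X) u.

Definition m_id (X : tree) : matching X X := Matching (prunes_refl X) (occ_id X).

Definition m_comp X Y Z (g : matching Y Z) (f : matching X Y) : matching X Z :=
  let a := addr (m_occ f) in
  Matching
    (prunes_trans (m_prune f) (restrict_pruning (addrP (m_occ f)) (m_prune g)))
    (occ_comp (m_occ g) (occ_clip (m_mid g) a)).

Lemma matching_eq X Y (f g : matching X Y) :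
  addr (m_occ f) = addr (m_occ g) -> f = g.
Proof.
case: f g => [T d [a aP]] [S e [b bP]] /= ab; subst b.
have TS : T = S by move: bP; rewrite aP => -[].
subst S; rewrite (Prop_irrelevance d e); congr Matching.
by rewrite (Prop_irrelevance aP bP).
Qed.

Lemma m_comp1m X Y (f : matching X Y) : m_comp (m_id Y) f = f.
Proof.
apply: matching_eq => /=; apply: clip_id.
by rewrite /position addrP.
Qed.

Lemma m_compm1 X Y (f : matching X Y) : m_comp f (m_id X) = f.
Proof. by apply: matching_eq => /=; rewrite cats0. Qed.

Lemma m_compA X Y Z W (h : matching Z W) (g : matching Y Z) (f : matching X Y) :
  m_comp h (m_comp g f) = m_comp (m_comp h g) f.
Proof.
apply: matching_eq => /=.
have posg : position Z (addr (m_occ g)) by rewrite /position addrP.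
rewrite (clip_cat _ posg (m_prune h)) catA; congr (_ ++ _).
exact: clip_clip (restrict_pruning (addrP (m_occ g)) (m_prune h)).
Qed.

Definition tree_cat : category :=
  @Category tree matching m_id m_comp m_comp1m m_compm1 m_compA.

Definition is_pruning (X Y : tree_cat) (f : hom X Y) : Prop :=
  exists d : prunes X Y, f = matching_of_pruning d.

Definition is_occurrence (X Y : tree_cat) (f : hom X Y) : Prop :=
  exists u : occurrence X Y, f = matching_of_occurrence u.

End Trees.

Arguments leaf {L ar}.
Arguments node {L ar l} f.
Arguments subtree {L ar} X a.
Arguments prunes {L ar} X T.

Section Augment.
Variable T : category.

(* [None] is the new object 0. *)
Definition aug_hom (X Y : option T) : Type :=
  match X, Y with
  | None, _ => unit
  | Some _, None => void
  | Some A, Some B => hom A B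
  end.

Definition aug_id (X : option T) : aug_hom X X :=
  if X is Some A then idm A else tt.

Definition aug_comp (X Y Z : option T) : aug_hom Y Z -> aug_hom X Y -> aug_hom X Z :=
  match X, Y, Z return aug_hom Y Z -> aug_hom X Y -> aug_hom X Z with
  | None, _, _ => fun _ _ => tt
  | Some _, None, _ => fun _ (f : void) => match f with end
  | Some _, Some _, None => fun g _ => g
  | Some A, Some B, Some C => fun g f => g ∘ f
  end.

Lemma aug_comp1m X Y (f : aug_hom X Y) : aug_comp (aug_id Y) f = f.
Proof. by case: X Y f => [A|] [B|] //= f; [exact: comp1m | case: f..]. Qed.

Lemma aug_compm1 X Y (f : aug_hom X Y) : aug_comp f (aug_id X) = f.
Proof. by case: X Y f => [A|] [B|] //= f; [exact: compm1 | case: f..]. Qed.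

Lemma aug_compA X Y Z W (h : aug_hom Z W) (g : aug_hom Y Z) (f : aug_hom X Y) :
  aug_comp h (aug_comp g f) = aug_comp (aug_comp h g) f.
Proof.
by case: X Y Z W h g f => [A|] [B|] [C|] [D|] //= h g f;
  [exact: compA | case: f..].
Qed.

Definition augment : category :=
  @Category (option T) aug_hom aug_id aug_comp aug_comp1m aug_compm1 aug_compA.

End Augment.

Record form (C : category) := Form {
  cl : C -> Type;
  cle : forall X Y : C, hom X Y -> cl X -> cl Y -> Prop;
  cle_refl : forall X (K : cl X), cle (idm X) K K;
  cle_trans : forall X Y Z (f : hom X Y) (g : hom Y Z)
      (K : cl X) (M : cl Y) (N : cl Z),
      cle f K M -> cle g M N -> cle (g ∘ f) K N;
  cle_anti : forall X (K M : cl X), cle (idm X) K M -> cle (idm X) M K -> K = M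
}.

Arguments cl {C} _ X.
Arguments cle {C _ X Y} _ _ _.

Notation "K '⊑[' f ']' M" := (cle f K M)
  (at level 70, f at next level, no associativity).
Notation "K ⊑ M" := (cle (idm _) K M) (at level 70, no associativity).

(* All the data below are uniquely determined by the form. *)
Record orean (C : category) (F : form C) := Orean {
  bot : forall X, cl F X;
  top : forall X, cl F X;
  meet : forall X, cl F X -> cl F X -> cl F X;
  join : forall X, cl F X -> cl F X -> cl F X;
  dir : forall X Y : C, hom X Y -> cl F X -> cl F Y;
  inv : forall X Y : C, hom X Y -> cl F Y -> cl F X;
  botP : forall X (K : cl F X), bot X ⊑ K;
  topP : forall X (K : cl F X), K ⊑ top X;
  meetP : forall X (K M N : cl F X), K ⊑ meet M N <-> K ⊑ M /\ K ⊑ N;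
  joinP : forall X (K M N : cl F X), join K M ⊑ N <-> K ⊑ N /\ M ⊑ N;
  dirP : forall X Y (f : hom X Y) (K : cl F X) (N : cl F Y),
      dir f K ⊑ N <-> K ⊑[f] N;
  invP : forall X Y (f : hom X Y) (K : cl F X) (N : cl F Y),
      K ⊑[f] N <-> K ⊑ inv f N;
  dir_id : forall X (K : cl F X), dir (idm X) K = K;
  dir_comp : forall X Y Z (g : hom Y Z) (f : hom X Y) (K : cl F X),
      dir (g ∘ f) K = dir g (dir f K);
  inv_id : forall X (K : cl F X), inv (idm X) K = K;
  inv_comp : forall X Y Z (g : hom Y Z) (f : hom X Y) (N : cl F Z),
      inv (g ∘ f) N = inv f (inv g N)
}.

Section Noetherian.
Variables (C : category) (F : form C) (O : orean F).

Definition Ker (X Y : C) (f : hom X Y) : cl F X := inv O f (bot O Y).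
Definition Im (X Y : C) (f : hom X Y) : cl F Y := dir O f (top O X).

Definition normal (X : C) (K : cl F X) : Prop :=
  exists (Y : C) (f : hom X Y), K = Ker f.

Definition conormal (Y : C) (N : cl F Y) : Prop :=
  exists (X : C) (f : hom X Y), N = Im f.

Definition universal_quotient_of (X : C) (K : cl F X) (Q : C) (q : hom X Q) : Prop :=
  K ⊑ Ker q /\
  forall (Y : C) (f : hom X Y), K ⊑ Ker f -> exists! g : hom Q Y, g ∘ q = f.

Definition universal_embedding_of (Y : C) (N : cl F Y) (A : C) (m : hom A Y) : Prop :=
  Im m ⊑ N /\
  forall (X : C) (f : hom X Y), Im f ⊑ N -> exists! g : hom X A, m ∘ g = f.

Definition universal_quotient (X Q : C) (q : hom X Q) : Prop :=
  exists K : cl F X, universal_quotient_of K q.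

Definition universal_embedding (A Y : C) (m : hom A Y) : Prop :=
  exists N : cl F Y, universal_embedding_of N m.

Record noetherian : Prop := Noetherian {
  inv_dir : forall (X Y : C) (f : hom X Y) (K : cl F X),
      inv O f (dir O f K) = join O K (Ker f);
  dir_inv : forall (X Y : C) (f : hom X Y) (N : cl F Y),
      dir O f (inv O f N) = meet O N (Im f);
  noeth_factor : forall (X Y : C) (f : hom X Y),
      exists (Q : C) (q : hom X Q) (m : hom Q Y),
        [/\ f = m ∘ q, universal_quotient_of (Ker f) q
          & universal_embedding_of (Im f) m];
  normal_join : forall (X : C) (K M : cl F X),
      normal K -> normal M -> normal (join O K M);
  conormal_meet : forall (X : C) (K M : cl F X),
      conormal K -> conormal M -> conormal (meet O K M)
}.

Definition largest_below (P : forall X : C, cl F X -> Prop)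
    (X : C) (K M : cl F X) : Prop :=
  [/\ P X M, M ⊑ K & forall N : cl F X, P X N -> N ⊑ K -> N ⊑ M].

Definition exact_join_decomposition : Prop :=
  exists n c : forall X : C, cl F X -> cl F X,
    [/\ forall X (K : cl F X), largest_below normal K (n X K),
        forall X (K : cl F X), largest_below conormal K (c X K),
        forall X (K : cl F X), K = join O (c X K) (n X K),
        forall (X Y : C) (f : hom X Y) (N : cl F Y),
          inv O f (n Y N) = n X (inv O f N)
      & forall (X Y : C) (f : hom X Y),
          dir O f (n X (top O X)) = n Y (Im f)].

End Noetherian.

Section MarkedPrunings.
(* An operadic expression tree category: [T] with an isomorphism [F] to the
   category of trees over a ranked set; prunings, occurrences and the object 1
   of [T] are transported along [F]. *)
Variables (L : Type) (ar : L -> nat) (T : category) (F : cat_iso T (tree_cat ar)).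

Definition classE (X Y : augment T) : hom X Y -> Prop :=
  match X, Y return @hom (augment T) X Y -> Prop with
  | Some A, Some B => fun f => is_pruning (fmap F f)
  | None, None => fun _ => True
  | _, _ => fun _ => False
  end.

Definition classM (X Y : augment T) : hom X Y -> Prop :=
  match X, Y return @hom (augment T) X Y -> Prop with
  | Some A, Some B => fun f => is_occurrence (fmap F f)
  | None, _ => fun _ => True
  | Some _, None => fun _ => False
  end.

Definition zero_or_one (U : augment T) : Prop :=
  if U is Some A then F A = leaf else True.

Record cospan (X : augment T) := Cospan {
  csQ : augment T;
  csU : augment T;
  csq : hom X csQ;
  csu : hom csU csQ;
  csqE : classE csq;
  csuM : classM csu;
  csU01 : zero_or_one csU
}.

Definition cospan_iso (X : augment T) (c d : cospan X) : Prop :=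
  exists (h : hom (csQ c) (csQ d)) (k : hom (csU c) (csU d)),
    [/\ isomorphism h, isomorphism k, h ∘ csq c = csq d
      & h ∘ csu c = csu d ∘ k].

Definition cospan_le (X Y : augment T) (f : hom X Y)
    (c : cospan X) (d : cospan Y) : Prop :=
  exists (h : hom (csQ c) (csQ d)) (k : hom (csU c) (csU d)),
    h ∘ csq c = csq d ∘ f /\ h ∘ csu c = csu d ∘ k.

Lemma cospan_le_refl X (c : cospan X) : cospan_le (idm X) c c.
Proof. by exists (idm _), (idm _); rewrite !comp1m !compm1. Qed.

Lemma cospan_le_trans X Y Z (f : hom X Y) (g : hom Y Z)
    (b : cospan X) (c : cospan Y) (d : cospan Z) :
  cospan_le f b c -> cospan_le g c d -> cospan_le (g ∘ f) b d.
Proof.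
move=> [h [k [hq hu]]] [h' [k' [hq' hu']]]; exists (h' ∘ h), (k' ∘ k).
by rewrite -!compA hq hu !compA hq' hu'.
Qed.

Lemma cospan_iso_le X (c d : cospan X) :
  cospan_iso c d -> cospan_le (idm X) c d.
Proof. by move=> [h [k [_ _ hq hu]]]; exists h, k; rewrite compm1. Qed.

Lemma cospan_iso_refl X (c : cospan X) : cospan_iso c c.
Proof.
have iso1 (Y : augment T) : isomorphism (idm Y) by exists (idm Y); rewrite comp1m.
by exists (idm _), (idm _); rewrite !comp1m compm1.
Qed.

Lemma cospan_iso_sym X (c d : cospan X) : cospan_iso c d -> cospan_iso d c.
Proof.
move=> [h [k [[h' [h'h hh']] [k' [k'k kk']] hq hu]]]; exists h', k'; split.
- by exists h.
- by exists k.
- by rewrite -hq compA h'h comp1m.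
- by rewrite -[csu d]compm1 -kk' (compA (csu d)) -hu !compA h'h comp1m.
Qed.

Lemma isomorphism_comp (C : category) (X Y Z : C) (g : hom Y Z) (f : hom X Y) :
  isomorphism g -> isomorphism f -> isomorphism (g ∘ f).
Proof.
move=> [g' [g'g gg']] [f' [f'f ff']]; exists (f' ∘ g'); split.
  by rewrite -compA (compA g') g'g comp1m.
by rewrite -compA (compA f) ff' comp1m.
Qed.

Lemma cospan_iso_trans X (b c d : cospan X) :
  cospan_iso b c -> cospan_iso c d -> cospan_iso b d.
Proof.
move=> [h [k [ih ik hq hu]]] [h' [k' [ih' ik' hq' hu']]].
exists (h' ∘ h), (k' ∘ k); split; try exact: isomorphism_comp.
  by rewrite -compA hq hq'.
by rewrite -compA hu !compA hu'.
Qed.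

Lemma classE_epi (X Q R : augment T) (q : hom X Q) (g h : hom Q R) :
  classE q -> g ∘ q = h ∘ q -> g = h.
Proof.
case: X Q R q g h => [A|] [B|] [D|] //= q g h; try by case: g h => [] [].
move=> [d Fq] /(congr1 (fmap F)); rewrite !fmap_comp Fq => E.
apply: (bij_inj (iso_hom_bij F B D)); apply: matching_eq.
by move/(congr1 (fun m : matching _ _ => addr (m_occ m))): E => /=; rewrite !cats0.
Qed.

Lemma zero_or_one_endo (U : augment T) (k : hom U U) : zero_or_one U -> k = idm U.
Proof.
case: U k => [A|] k; last by case: k.
move=> /= FA; apply: (bij_inj (iso_hom_bij F A A)); rewrite fmap_id.
apply: matching_eq; move: (fmap F k) => m.
have := addrP (m_occ m); rewrite /= [X in subtree X _]FA.
by case: (addr _).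
Qed.

Lemma cospan_le_anti X (c d : cospan X) :
  cospan_le (idm X) c d -> cospan_le (idm X) d c -> cospan_iso c d.
Proof.
move=> [h [k [hq hu]]] [h' [k' [hq' hu']]]; exists h, k.
rewrite compm1 in hq; rewrite compm1 in hq'; split => //.
- exists h'; split.
    by apply: (classE_epi (csqE c)); rewrite -compA hq hq' comp1m.
  by apply: (classE_epi (csqE d)); rewrite -compA hq' hq comp1m.
- by exists k'; split; apply: zero_or_one_endo; apply: csU01.
Qed.

HB.instance Definition _ (X : augment T) := gen_eqMixin (cospan X).
HB.instance Definition _ (X : augment T) := gen_choiceMixin (cospan X).

Definition cospan_isob (X : augment T) : rel (cospan X) :=
  fun c d => `[< cospan_iso c d >].

Lemma cospan_isob_refl X : reflexive (@cospan_isob X).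
Proof. by move=> c; apply/asboolP; exact: cospan_iso_refl. Qed.

Lemma cospan_isob_sym X : symmetric (@cospan_isob X).
Proof. by move=> c d; apply/asboolP/asboolP; exact: cospan_iso_sym. Qed.

Lemma cospan_isob_trans X : transitive (@cospan_isob X).
Proof.
move=> c b d /asboolP bc /asboolP cd; apply/asboolP; exact: cospan_iso_trans bc cd.
Qed.

Canonical cospan_equiv (X : augment T) : equiv_rel (cospan X) :=
  EquivRel (@cospan_isob X) (@cospan_isob_refl X) (@cospan_isob_sym X)
           (@cospan_isob_trans X).

Definition cluster (X : augment T) : Type := {eq_quot (cospan_equiv X)}%qT.

(* Independent of the choice of representatives by [cluster_leE]. *)
Definition cluster_le (X Y : augment T) (f : hom X Y)
    (K : cluster X) (N : cluster Y) : Prop :=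
  cospan_le f (repr K) (repr N).

Lemma repr_cospan_iso X (c : cospan X) :
  cospan_iso (repr (\pi_{eq_quot (cospan_equiv X)}%qT c)) c.
Proof.
by apply/asboolP; have /eqmodP := reprK (\pi_{eq_quot (cospan_equiv X)}%qT c).
Qed.

Lemma cluster_leE (X Y : augment T) (f : hom X Y) (c : cospan X) (d : cospan Y) :
  cluster_le f (\pi_{eq_quot (cospan_equiv X)}%qT c)
               (\pi_{eq_quot (cospan_equiv Y)}%qT d) <-> cospan_le f c d.
Proof.
have ic := repr_cospan_iso c; have jd := repr_cospan_iso d.
have move_le c1 c2 d1 d2 : cospan_iso c1 c2 -> cospan_iso d1 d2 ->
    cospan_le f c1 d1 -> cospan_le f c2 d2.
  move=> i12 j12 le; have -> : f = idm Y ∘ (f ∘ idm X) by rewrite compm1 comp1m.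
  apply: cospan_le_trans _ (cospan_iso_le j12).
  exact: cospan_le_trans (cospan_iso_le (cospan_iso_sym i12)) le.
split; first exact: move_le ic jd.
exact: move_le (cospan_iso_sym ic) (cospan_iso_sym jd).
Qed.

Lemma cluster_le_refl X (K : cluster X) : cluster_le (idm X) K K.
Proof. exact: cospan_le_refl. Qed.

Lemma cluster_le_trans X Y Z (f : hom X Y) (g : hom Y Z)
    (K : cluster X) (M : cluster Y) (N : cluster Z) :
  cluster_le f K M -> cluster_le g M N -> cluster_le (g ∘ f) K N.
Proof. exact: cospan_le_trans. Qed.

Lemma cluster_le_anti X (K M : cluster X) :
  cluster_le (idm X) K M -> cluster_le (idm X) M K -> K = M.
Proof.
move=> KM MK; rewrite -[K]reprK -[M]reprK; apply/eqmodP/asboolP.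
exact: cospan_le_anti KM MK.
Qed.

Definition marked_prunings : form (augment T) :=
  @Form (augment T) cluster cluster_le
    cluster_le_refl cluster_le_trans cluster_le_anti.

End MarkedPrunings.

(* Main.v *)
(* A cluster over a tree X is a pruning of X, possibly with a marked empty leaf.
   Record it as a pair (P, s): P is the prefix-closed set of the addresses of the
   nodes (as opposed to empty leaves) of the pruning, and s is the address of the
   mark, if there is one.  For f : X -> Y with occurrence at address a, the relation
   (P, s) <=_f (R, t) then says that a c in R implies c in P, and that if s = b then
   t is a prefix of a b.  This makes the lattice operations and the direct and inverse
   images explicit.  Meets unite the P's and keep the longer of two comparable marks;
   joins intersect the P's, remove every address extending the longest common prefix
   of the marks, and retract the mark to its shortest prefix outside the result.  The
   normal clusters are the unmarked ones, and the conormal clusters over a tree are,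
   besides the bottom, the prunings that cut exactly one subtree and mark the cut. *)
From mathcomp Require Import all_boot.
From mathcomp Require Import boolp.
Require Import Defs.

Set Implicit Arguments.
Unset Strict Implicit.
Unset Printing Implicit Defensive.

Implicit Types (a b c m : seq nat) (P R : pred (seq nat)) (s t : option (seq nat)).

(** * Prefixes of words and the first exit from a set of words *)

Lemma prefix_comparable a b c : prefix a c -> prefix b c -> prefix a b || prefix b a.
Proof.
elim: a b c => [|x a IH] [|y b] [|z c] //=; rewrite ?prefix0s ?orbT //.
by move=> /andP[/eqP -> ac] /andP[/eqP -> bc]; rewrite eqxx (IH _ _ ac bc).
Qed.

Lemma prefix_anti a b : prefix a b -> prefix b a -> a = b.
Proof.
by elim: a b => [|x a IH] [|y b] //= /andP[/eqP -> ab] /andP[_ /(IH _ ab) ->].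
Qed.

Lemma prefix_cat2l a b c : prefix (a ++ b) (a ++ c) = prefix b c.
Proof. by elim: a => //= x a ->; rewrite eqxx. Qed.

Fixpoint lcp a b : seq nat :=
  match a, b with
  | x :: a', y :: b' => if x == y then x :: lcp a' b' else [::]
  | _, _ => [::]
  end.

Lemma prefix_lcp c a b : prefix c (lcp a b) = prefix c a && prefix c b.
Proof.
elim: c a b => [|z c IH] [|x a] [|y b] //=; rewrite ?andbF ?prefix0s //.
case: (eqVneq x y) => [<-|xy] /=; last by case: (eqVneq z x) => //= ->; rewrite (negPf xy) andbF.
by rewrite IH; case: eqP.
Qed.

Definition prefix_closed P := forall a b, P (a ++ b) -> P a.

(* [b] is the shortest of its prefixes that lies outside [P]. *)
Definition exits P b := forall c, prefix c b -> P c = (c != b).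

(** If every prefix of [m] lies in [P], the value is [m] itself; otherwise it is the shortest prefix
    outside [P]. *)
Fixpoint exit_prefix P m : seq nat :=
  if m is x :: m' then
    if P [::] then x :: exit_prefix (fun c => P (x :: c)) m' else [::]
  else [::].

Lemma exit_prefix_prefix P m : prefix (exit_prefix P m) m.
Proof.
elim: m P => //= x m IH P; case: ifP => _ //.
by rewrite /= eqxx IH.
Qed.

Lemma exit_prefixP P m : ~~ P m -> exits P (exit_prefix P m).
Proof.
elim: m P => [|x m IH] P /= Pm c; first by rewrite prefixs0 => /eqP ->; apply/negbTE.
case: ifPn => [P0|P0]; last by rewrite prefixs0 => /eqP ->; apply/negbTE.
case: c => [|y c] //= /andP[/eqP -> cm].
by rewrite (IH _ Pm _ cm) eqseq_cons eqxx.
Qed.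

(** The walk along [m] cannot stop strictly before [b] while it is still inside [P]. This bounds
    from below how far a retracted mark can move. *)
Lemma exit_prefix_max P b m : prefix b m ->
  (forall c, prefix c b -> c != b -> P c) -> prefix b (exit_prefix P m).
Proof.
elim: m P b => [|x m IH] P [|y b] //=; first by rewrite prefix0s.
move=> /andP[/eqP -> bm] Pb.
rewrite Pb ?prefix0s //= eqxx; apply: IH => // c cb cneq.
by apply: Pb; rewrite /= ?eqxx // eqseq_cons eqxx.
Qed.

(** * Order, lattice operations and restriction of marks *)

Definition mark_le a s t : bool :=
  if s is Some b then (if t is Some t' then prefix t' (a ++ b) else false) else true.

(** The longer mark is the smaller one. Incomparable addresses have no common extension, so their
    meet is the absence of a mark. *)
Definition mark_meet s t : option (seq nat) :=
  match s, t with
  | Some b, Some c => if prefix b c then Some c else if prefix c b then Some b else None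
  | _, _ => None
  end.

Definition mark_join s t : option (seq nat) :=
  match s, t with
  | Some b, Some c => Some (lcp b c)
  | None, _ => t
  | _, None => s
  end.

(** Right adjoint to prepending [a]. A mark at or above [a] imposes nothing on a word below [a] and
    becomes the top mark [[::]]; a mark below [a] loses its prefix [a]; an incomparable one bounds
    no marked word below [a]. *)
Definition mark_res a t : option (seq nat) :=
  if t is Some c then
    if prefix c a then Some [::] else if prefix a c then Some (drop (size a) c) else None
  else None.

Lemma mark_le_meet a s t t' :
  mark_le a s (mark_meet t t') = mark_le a s t && mark_le a s t'.
Proof.
case: s t t' => [b|] [c|] [c'|] //=; rewrite ?andbF //.
case: ifPn => [cc'|ncc'].
  by apply/idP/andP => [h|[]//]; split=> //; apply: prefix_trans cc' h.
case: ifPn => [c'c|nc'c].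
  by apply/idP/andP => [h|[]//]; split=> //; apply: prefix_trans c'c h.
apply/esym/negbTE/negP => /andP[h h'].
by have := prefix_comparable h h'; rewrite (negPf ncc') (negPf nc'c).
Qed.

Lemma mark_le_join s s' t :
  mark_le [::] (mark_join s s') t = mark_le [::] s t && mark_le [::] s' t.
Proof. by case: s s' t => [b|] [b'|] [c|] //=; rewrite ?andbT // prefix_lcp. Qed.

Lemma mark_le_res a s t : mark_le a s t = mark_le [::] s (mark_res a t).
Proof.
case: s t => [b|] [c|] //=.
case: ifPn => [ca|nca]; first by rewrite prefix0s; apply: prefix_trans ca (prefix_prefix _ _).
case: ifPn => [/prefixP[d ->]|nac]; first by rewrite drop_size_cat // prefix_cat2l.
apply/negbTE/negP => cab.
by have := prefix_comparable cab (prefix_prefix a b); rewrite (negPf nca) (negPf nac).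
Qed.

Lemma mark_le_cat a b s t : mark_le (a ++ b) s t = mark_le b s (mark_res a t).
Proof.
by case: s => // c; have := mark_le_res a (Some (b ++ c)) t; rewrite /mark_le catA.
Qed.

Lemma mark_res_cat a b : mark_res a (Some (a ++ b)) = Some b.
Proof.
rewrite /= prefix_prefix drop_size_cat //; case: ifP => //.
by rewrite -[X in prefix _ X]cats0 prefix_cat2l prefixs0 => /eqP ->.
Qed.

(** The mark component of the axiom that equates the direct image of an inverse image with the meet
    with [Im f], whose mark is the address of [f]. *)
Lemma mark_meet_res a t : mark_meet t (Some a) = omap (cat a) (mark_res a t).
Proof.
case: t => [c|] //=; case: ifP => _ /=; first by rewrite cats0.
by case: ifP => //= /prefixP[d ->]; rewrite drop_size_cat.
Qed.

(* The first component is the set of node addresses of a pruning, the second the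
   address of its mark; an empty leaf or an address outside the tree is not in the set. *)
Definition code : Type := (pred (seq nat) * option (seq nat))%type.

Definition code_le a (k n : code) : Prop :=
  (forall c, n.1 (a ++ c) -> k.1 c) /\ mark_le a k.2 n.2.

Lemma code_le_anti k n : code_le [::] k n -> code_le [::] n k -> k = n.
Proof.
case: k n => [P s] [R t] [/= RP st] [/= PR ts]; congr pair.
  by apply/funext => c; apply/idP/idP; [exact: PR|exact: RP].
case: s t st ts {RP PR} => [b|] [c|] //= h h'; congr Some; exact: prefix_anti.
Qed.

(** * Prunings as prefix-closed sets of node addresses *)

Section TreeLemmas.
Variables (L : Type) (ar : L -> nat).
Implicit Types X Y Q S : tree ar.

Definition isnode X a : bool := if subtree X a is Some (node _ _) then true else false.

Lemma isnode_closed X : prefix_closed (isnode X).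
Proof.
move=> a b; rewrite /isnode subtree_cat; case: (subtree X a) => [[|l f]|] //=.
by case: b.
Qed.

Lemma subtree_isnode Y S a c : subtree Y a = Some S -> isnode Y (a ++ c) = isnode S c.
Proof. by rewrite /isnode subtree_cat => ->. Qed.

Lemma prunes_isnode X S a : prunes X S -> isnode S a -> isnode X a.
Proof.
rewrite /isnode; elim: a X S => [|p a IH] X [|l g] //= XS; case: (prunes_inv XS) => f -> fg //=.
by case: insub => [i|] //=; apply: IH.
Qed.

Lemma prunes_node_inv l (f : {ffun 'I_(ar l) -> tree ar}) Q : prunes (node f) Q ->
  Q = leaf \/ exists2 g : {ffun 'I_(ar l) -> tree ar}, Q = node g & forall i, prunes (f i) (g i).
Proof.
(* A match on a variable [X] lets case analysis on the pruning avoid equalities between dependent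
   pairs. *)
suff inv X : prunes X Q -> if X is node l f then
    Q = leaf \/ exists2 g : {ffun 'I_(ar l) -> tree ar}, Q = node g & forall i, prunes (f i) (g i)
  else True by apply: inv.
by case=> [[|l' f']|l' f' g fg] //; [left|right; exists g].
Qed.

(** Node sets do not record labels; the common source [X] makes the labels of [Q] and [S] agree, and
    inclusion of node sets then suffices. *)
Lemma prunes_of_isnode X Q S : prunes X Q -> prunes X S ->
  (forall a, isnode S a -> isnode Q a) -> prunes Q S.
Proof.
elim/tree_ind_children: S X Q => [|l g IH] X Q; first by constructor.
move=> XQ; move=> XS QS; case: (prunes_inv XS) => f eX fg; subst X.
have : isnode Q [::] by apply: QS.
case: (prunes_node_inv XQ) QS => [-> //|[h -> fh]] gh _.
constructor=> i; apply: IH (fh i) (fg i) _ => a ga.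
by have := gh (val i :: a); rewrite /isnode /= valK; apply.
Qed.

(** Inverse to taking node sets: by [isnode_cut] and [cut_isnode], the prunings of [X] correspond to
    the prefix-closed sets of nodes of [X]. *)
Fixpoint cut X P {struct X} : tree ar :=
  match X with
  | leaf => leaf
  | node l f =>
      if P [::] then node [ffun i : 'I_(ar l) => cut (f i) (fun a => P (val i :: a))] else leaf
  end.

Lemma prunes_cut X P : prunes X (cut X P).
Proof.
elim/tree_ind_children: X P => [|l f IH] P /=; first by constructor.
by case: ifP => _; constructor=> i; rewrite ffunE.
Qed.

Lemma isnode_cut X P : prefix_closed P -> (forall a, P a -> isnode X a) ->
  isnode (cut X P) = P.
Proof.
move=> clP PX; apply/funext => a; elim: a X P clP PX => [|p a IH] [|l f] P clP PX /=.
- by apply/esym/negbTE/negP => /PX.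
- by rewrite /isnode /=; case: ifP.
- by apply/esym/negbTE/negP => /PX.
case: ifPn => [P0|nP0]; last by apply/esym/negbTE; apply: contra nP0; exact: (clP [::]).
rewrite /isnode /=; have := PX (p :: a); rewrite /isnode /=.
case: insubP => [i _ <-|_] H; last by apply/esym/negbTE/negP => /H.
rewrite ffunE; apply: (IH _ (fun a => P (val i :: a))) => [b c|b Pb].
  exact: (clP (val i :: b)).
by have := PX _ Pb; rewrite /isnode /= valK.
Qed.

Lemma cut_isnode X S : prunes X S -> cut X (isnode S) = S.
Proof.
elim/tree_ind_children: X S => [|l f IH] S XS.
  by case: S XS => // l g XS; case: (prunes_inv XS).
case: (prunes_node_inv XS) => [->|[g -> fg]] //=; congr node; apply/ffunP => i.
rewrite ffunE -[RHS](IH i _ (fg i)); congr cut.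
by apply/funext => a; rewrite /isnode /= valK.
Qed.

Lemma prunes_anti X S : prunes X S -> prunes S X -> X = S.
Proof.
move=> XS SX; rewrite -[X in X = _](cut_isnode (prunes_refl X)) -(cut_isnode XS).
by congr cut; apply/funext => a; apply/idP/idP; apply: prunes_isnode.
Qed.

(* Every letter of [b] that is read at a node of [X] is the index of a child. *)
Fixpoint fits X b {struct b} : bool :=
  match b, X with
  | p :: b', node l f => if (insub p : option 'I_(ar l)) is Some i then fits (f i) b' else false
  | _, _ => true
  end.

Lemma fits_prefix X a b : prefix a b -> fits X b -> fits X a.
Proof.
elim: a b X => [|p a IH] [|q b] [|l f] //= /andP[/eqP -> ab].
by case: insub => // i; apply: IH.
Qed.

Lemma prunes_fits X S b : prunes X S -> fits X b -> fits S b.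
Proof.
elim: b X S => [|p b IH] X [|l g] //= XS; case: (prunes_inv XS) => f -> fg /=.
by case: insub => // i; apply: IH.
Qed.

(** Every letter of [b] is read at a node of [S], which is a node of [X] with the same label and so
    the same arity. *)
Lemma fits_of_prunes X S b : prunes X S ->
  (forall c, prefix c b -> c != b -> isnode S c) -> fits S b -> fits X b.
Proof.
elim: b X S => [|p b IH] X [|l g]; try by case: X.
  by move=> _ /(_ [::]) /= /(_ isT isT).
move=> XS; case: (prunes_inv XS) => f -> fg Sb /=; case E: insub => [i|] //.
apply: IH (fg i) _ => c cb cneq; have := Sb (p :: c).
by rewrite /= eqxx cb eqseq_cons eqxx /isnode /= E; apply.
Qed.

Lemma position_of_fits X b : fits X b ->
  (forall c, prefix c b -> c != b -> isnode X c) -> position X b.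
Proof.
elim: b X => [|p b IH] [|l f] //=; first by move=> _ /(_ [::] isT isT).
rewrite /position /=; case E: insub => [i|] // fb Xb; apply: IH fb _ => c cb cneq.
by have := Xb (p :: c); rewrite /isnode /= E eqxx cb eqseq_cons eqxx; apply.
Qed.

Lemma subtree_fits Y S a b : subtree Y a = Some S -> fits Y (a ++ b) = fits S b.
Proof.
elim: a Y => [|p a IH] [|l f] //=; try by move=> [->].
by case: insub => // i; apply: IH.
Qed.

(** As [a] fits, clipping shortens it only where it runs through an empty leaf, and then both sides
    are false. For a letter that is not the index of a child, clipping would stop at a genuine node
    instead. *)
Lemma isnode_subtree_clip S a c : fits S a -> isnode (subtree_clip S a) c = isnode S (a ++ c).
Proof.
rewrite /subtree_clip; elim: a S => [|p a IH] [|l f] //=; first by case: (c).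
rewrite /isnode /=; case E: insub => [i|] //= fa.
by rewrite E; exact: IH.
Qed.

(** Expresses being an empty leaf, hence a possible place of a mark, through the node set alone once
    [b] fits. *)
Lemma subtree_leafP S b : subtree S b = Some leaf <-> fits S b /\ exits (isnode S) b.
Proof.
split.
  elim: b S => [|p b IH] [|l f] //=; try by move=> _; split=> // [] [].
  case E: insub => [i|] // /IH[fb eb]; split=> // -[|q c] //= /andP[/eqP -> cb].
  by have := eb c cb; rewrite /isnode /= E eqseq_cons eqxx.
elim: b S => [|p b IH] [|l f] /= [fb eb] //.
- by have := eb [::]; rewrite /isnode /= => /(_ isT).
- by have := eb [::]; rewrite /isnode /= => /(_ isT).
case E: insub fb => [i|] // fb; apply: IH; split=> // c cb.
by have := eb (p :: c); rewrite /isnode /= E eqxx cb eqseq_cons eqxx; apply.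
Qed.

Lemma clip_isnode S a : fits S a -> isnode S (clip S a) -> clip S a = a.
Proof.
elim: a S => [|p a IH] [|l f] //=; rewrite /isnode.
by case E: insub => [i|] //=; rewrite E => fa ca; rewrite (IH _ fa ca).
Qed.

Lemma clip_leaf S b m : subtree S b = Some leaf -> prefix b m -> clip S m = b.
Proof.
elim: b m S => [|p b IH] [|q m] [|l f] //= sb /andP[/eqP <- bm].
by move: sb; case E: insub => [i|] // /IH ->.
Qed.

End TreeLemmas.

(** * Morphisms as addresses and clusters as codes *)

Section Matchings.
Variables (L : Type) (ar : L -> nat) (T : category) (F : cat_iso T (tree_cat ar)).

(** Morphisms out of [0] get the default [[::]]. This keeps [hom_addr_inj] true, as each hom-set out
    of [0] has one element. *)
Definition hom_addr (X Y : augment T) : hom X Y -> seq nat :=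
  match X, Y return @hom (augment T) X Y -> seq nat with
  | Some A, Some B => fun f => addr (m_occ (fmap F f : matching (F A) (F B)))
  | _, _ => fun=> [::]
  end.

Local Notation some A := (Some A : Ob (augment T)).

Lemma hom_addrP (A B : T) (f : hom (some A) (some B)) :
  exists2 S : tree ar, subtree (F B) (hom_addr f) = Some S & prunes (F A : tree ar) S.
Proof.
exists (m_mid (fmap F f : matching (F A) (F B))); first exact: addrP.
exact: m_prune.
Qed.

Lemma hom_addr_inj (X Y : augment T) (f g : hom X Y) : hom_addr f = hom_addr g -> f = g.
Proof.
case: X Y f g => [A|] [B|] //= f g; try by case: f g => [] [].
by move=> /matching_eq; apply: (bij_inj (iso_hom_bij F A B)).
Qed.

Lemma hom_of_addr (A B : T) a (S : tree ar) : subtree (F B) a = Some S ->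
  prunes (F A : tree ar) S -> exists f : hom (some A) (some B), hom_addr f = a.
Proof.
move=> Ba AS; case: (iso_hom_bij F A B) => G _ GK.
by exists (G (Matching AS (Occurrence Ba))); rewrite /= GK.
Qed.

Lemma obj_of_tree (S : tree ar) : exists A : T, F A = S.
Proof. by case: (iso_obj_bij F) => G _ GK; exists (G S). Qed.

Lemma hom_addr_comp (A B C : T) (g : hom (some B) (some C)) (f : hom (some A) (some B)) S :
  subtree (F C) (hom_addr g) = Some S ->
  hom_addr (g ∘ f) = hom_addr g ++ clip S (hom_addr f).
Proof. by rewrite /= addrP => -[<-]; rewrite fmap_comp. Qed.

Lemma hom_addr_id (X : augment T) : hom_addr (idm X) = [::].
Proof. by case: X => //= A; rewrite fmap_id. Qed.

Lemma classE_addr (A B : T) (f : hom (some A) (some B)) :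
  classE F f <-> hom_addr f = [::].
Proof.
split; first by move=> /= [d ->].
move=> fnil; have [S] := hom_addrP f; rewrite fnil /= => -[<-] AB.
by exists AB; apply: matching_eq; rewrite [LHS]fnil.
Qed.

Lemma classM_addr (A B : T) (f : hom (some A) (some B)) :
  classM F f <-> subtree (F B) (hom_addr f) = Some (F A : tree ar).
Proof.
split; first by move=> /= [u ->]; rewrite /= addrP.
by move=> fA; exists (Occurrence fA); apply: matching_eq.
Qed.

#[global] Arguments hom_addr : simpl never.

Lemma classE_prunes (A B : T) (f : hom (some A) (some B)) :
  classE F f -> prunes (F A : tree ar) (F B).
Proof. by move/classE_addr => f0; have [S] := hom_addrP f; rewrite f0 /= => -[<-]. Qed.

Lemma prunes_leaf_inv (S : tree ar) : prunes leaf S -> S = leaf.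
Proof. by case: S => // l g H; case: (prunes_inv H). Qed.

Lemma hom_addr_leaf (U B : T) (u : hom (some U) (some B)) :
  F U = leaf -> subtree (F B) (hom_addr u) = Some leaf.
Proof. by move=> U1; have [S ->] := hom_addrP u; rewrite U1 => /prunes_leaf_inv ->. Qed.

(* The adjoined object 0 is treated as a tree all of whose addresses are nodes:
   its only code is then [(xpredT, None)], which lies below every code. *)
Definition obj_node (X : augment T) : pred (seq nat) :=
  if X is Some A then isnode (F A : tree ar) else xpredT.

Definition obj_fits (X : augment T) : pred (seq nat) :=
  if X is Some A then fits (F A : tree ar) else xpred0.

(** These conditions cut out exactly the image of [cospan_code], by [cospan_codeP] and
    [cospan_of_code]. The condition on the mark says that it sits at an empty leaf of the
    pruning. *)
Record code_of (X : augment T) (k : code) : Prop := CodeOf {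
  code_node : forall a, k.1 a -> obj_node X a;
  code_closed : prefix_closed k.1;
  code_mark : forall b, k.2 = Some b -> obj_fits X b /\ exits k.1 b;
  code_zero : X = None -> forall a, k.1 a
}.

Lemma obj_node_closed X : prefix_closed (obj_node X).
Proof. by case: X => // A; apply: isnode_closed. Qed.

Lemma obj_fits_prefix X a b : prefix a b -> obj_fits X b -> obj_fits X a.
Proof. by case: X => // A; apply: fits_prefix. Qed.

Lemma code_of_zero k : code_of None k -> k = (xpredT, None).
Proof.
case: k => P s [/= _ _ ms all]; congr pair; first by apply/funext => a; rewrite all.
by case: s ms => // b /(_ b erefl) [].
Qed.

Lemma obj_node_addr (X Y : augment T) (f : hom X Y) a :
  obj_node Y (hom_addr f ++ a) -> obj_node X a.
Proof.
case: X Y f => [A|] [B|] //= f.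
have [S AS BS] := hom_addrP f; move: AS; rewrite /= => AS.
rewrite (subtree_isnode _ AS); exact: prunes_isnode.
Qed.

Lemma hom_addr_node (X Y : augment T) (f : hom X Y) b :
  prefix b (hom_addr f) -> b != hom_addr f -> obj_node Y b.
Proof.
case: X Y f => [A|] [B|] //; try by move=> f; rewrite /hom_addr prefixs0 => ->.
move=> f /prefixP[[|p d] e]; rewrite e ?cats0 ?eqxx //= => _.
have [S] := hom_addrP f; rewrite e subtree_cat /obj_node /isnode.
by case: subtree => [[|l g]|].
Qed.

Definition cospan_code (X : augment T) (c : cospan F X) : code :=
  (obj_node (csQ c), if csU c is Some _ then Some (hom_addr (csu c)) else None).

Lemma cospan_codeP (X : augment T) (c : cospan F X) : code_of X (cospan_code c).
Proof.
case: X c => [A|] [[B|] [U|] // q u qE uM U01].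
- split=> // [a|a b|_ [<-]].
  + exact: (prunes_isnode (classE_prunes qE)).
  + exact: isnode_closed.
  move: (hom_addr_leaf u U01)=> /subtree_leafP[Bu eu]; split=> //.
  by apply: fits_of_prunes (classE_prunes qE) _ Bu => c cu cneq; rewrite eu.
- split=> // [a|a b].
  + exact: (prunes_isnode (classE_prunes qE)).
  exact: isnode_closed.
Qed.

(** For trees, the equation [h ∘ q = r ∘ f] fixes the address of [h] as that of [f] clipped to the
    target pruning, so [h] exists iff one node set contains the other below that address. The mark
    [u] is then sent to a clipped word, and [k] exists iff this word is the address of [v]. *)
Lemma cospan_le_code (X Y : augment T) (f : hom X Y) (c : cospan F X) (d : cospan F Y) :
  cospan_le f c d <-> code_le (hom_addr f) (cospan_code c) (cospan_code d).
Proof.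
case: X Y f c d => [A|] [A'|] // f; last first.
- by move=> [[B|] [U|] // q u qE uM U01] [[B'|] [V|] // r v rE vM V01]; split=> // _;
    exists (tt : @hom (augment T) None None), (tt : @hom (augment T) None None).
- move=> [[B|] [U|] // q u qE uM U01] [B' V r v rE vM V01]; split=> // _.
  by exists (tt : @hom (augment T) None B'), (tt : @hom (augment T) None V).
move=> [[B|] U // q u qE uM U01] [[B'|] V // r v rE vM V01].
rewrite /code_le /=.
have AB := classE_prunes qE; have AB' := classE_prunes rE.
have q0 : hom_addr q = [::] by apply/classE_addr.
have r0 : hom_addr r = [::] by apply/classE_addr.
have [S A'f AS] := hom_addrP f; set a := hom_addr f in A'f *.
have A'a : position (F A') a by rewrite /position A'f.
have fitsa : fits (F B') a.
  by apply: prunes_fits AB' _; rewrite -[a]cats0 (subtree_fits _ A'f); case: (S).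
have rf : hom_addr (r ∘ f) = clip (F B') a.
  by rewrite (@hom_addr_comp _ _ _ r f (F B')) r0.
have hq (h : hom (some B) (some B')) : hom_addr (h ∘ q) = hom_addr h.
  by have [R hR _] := hom_addrP h; rewrite (hom_addr_comp _ hR) q0 cats0.
have nodes : prunes (F B : tree ar) (subtree_clip (F B') a) <->
    (forall c, isnode (F B' : tree ar) (a ++ c) -> isnode (F B : tree ar) c).
  split=> [pr c|nodes].
    by rewrite -isnode_subtree_clip //; apply: prunes_isnode.
  (* [F B] and the clipped subtree are both prunings of [F A], so comparing node sets is enough. *)
  apply: prunes_of_isnode AB _ _.
    exact: prunes_trans AS (restrict_pruning A'f AB').
  by move=> c; rewrite isnode_subtree_clip //; apply: nodes.
have hexists : (forall c, isnode (F B' : tree ar) (a ++ c) -> isnode (F B : tree ar) c) <->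
    exists h : hom (some B) (some B'), h ∘ q = r ∘ f.
  rewrite -nodes; split=> [pr|[h /(congr1 (@hom_addr _ _))]].
    have [h hE] := hom_of_addr (subtree_at_clip (F B') a) pr.
    by exists h; apply: hom_addr_inj; rewrite hq rf hE.
  rewrite hq rf => hE; have [R] := hom_addrP h.
  by rewrite hE subtree_at_clip => -[<-].
case: U u uM U01 => [U|] u uM U01; last first.
  split=> [[h [k [hqE _]]]|[/hexists[h hqE] _]].
    by split=> //; apply/hexists; exists h.
  by exists h, tt.
have Bu := hom_addr_leaf u U01.
have hu (h : hom (some B) (some B')) : h ∘ q = r ∘ f ->
    hom_addr (h ∘ u) = clip (F B') (a ++ hom_addr u).
  move=> /(congr1 (@hom_addr _ _)); rewrite hq rf => hE.
  rewrite (@hom_addr_comp _ _ _ h u (subtree_clip (F B') a)); last first.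
    by rewrite hE subtree_at_clip.
  by rewrite hE (clip_cat _ A'a AB').
case: V v vM V01 => [V|] v vM V01; last first.
  by split=> [[h [[]]]|[]].
have B'v := hom_addr_leaf v V01.
(* The source of [v] is the empty leaf, in which every address clips to [[::]]. *)
have vk (k : hom (some U) (some V)) : hom_addr (v ∘ k) = hom_addr v.
  by rewrite (hom_addr_comp _ B'v); case: (hom_addr k) => [|p e]; rewrite cats0.
split=> [[h [k [hqE huE]]]|[/hexists[h hqE] vu]].
  split; first by apply/hexists; exists h.
  by rewrite /= -(vk k) -huE (hu h hqE) clip_prefix.
(* Both marks have the empty leaf as source, so a map between them exists at the root. *)
have [k _] : exists k : hom (some U) (some V), hom_addr k = [::].
  by apply: (@hom_of_addr _ _ _ leaf); [rewrite V01|constructor].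
(* A word extending the address of an empty leaf clips to that address; this turns the prefix
   relation into the equation for the marks. *)
exists h, k; split=> //; apply: hom_addr_inj.
by rewrite (hu h hqE) vk; apply: clip_leaf vu.
Qed.

(** The pruning comes from [cut] along the node set, and [subtree_leafP] finds an empty leaf of it
    at the address of the mark. *)
Lemma cospan_of_code (X : augment T) (k : code) : code_of X k ->
  exists c : cospan F X, cospan_code c = k.
Proof.
case: X => [A|] kP; last first.
  exists (@Cospan _ _ _ F None None None (idm _) (idm _) I I I).
  by rewrite (code_of_zero kP).
case: k kP => P s [/= PA Pcl Ps _].
have [B FB] := obj_of_tree (cut (F A) P).
have AB : prunes (F A : tree ar) (F B) by rewrite FB; apply: prunes_cut.
have [q q0] := @hom_of_addr A B [::] _ erefl AB.
have qE : classE F q by apply/classE_addr.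
have nodeB : isnode (F B : tree ar) = P by rewrite FB isnode_cut.
case: s Ps => [b|] Ps; last first.
  exists (@Cospan _ _ _ F _ _ None q tt qE I I).
  by rewrite /cospan_code /= nodeB.
have [Ab eb] := Ps b erefl.
have [U FU] := obj_of_tree leaf.
have Bb : subtree (F B) b = Some leaf.
  apply/subtree_leafP; split; first exact: prunes_fits AB Ab.
  by rewrite nodeB.
have [u ub] := @hom_of_addr U B b leaf Bb ltac:(constructor).
have uM : classM F u by apply/classM_addr; rewrite ub Bb FU.
exists (@Cospan _ _ _ F _ _ (some U) q u qE uM FU).
by rewrite /cospan_code ub /= nodeB.
Qed.

(** Locked so that simplification does not unfold the chosen representative. *)
Definition cluster_code (X : augment T) (K : cl (marked_prunings F) X) : code :=
  locked (cospan_code (repr (K : cluster F X))).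

Lemma cluster_codeP (X : augment T) (K : cl (marked_prunings F) X) :
  code_of X (cluster_code K).
Proof. by rewrite /cluster_code -lock; apply: cospan_codeP. Qed.

Lemma cleE (X Y : augment T) (f : hom X Y) (K : cl (marked_prunings F) X)
    (N : cl (marked_prunings F) Y) :
  K ⊑[f] N <-> code_le (hom_addr f) (cluster_code K) (cluster_code N).
Proof. by rewrite /cluster_code -!lock; apply: cospan_le_code. Qed.

Lemma cle_idE (X : augment T) (K N : cl (marked_prunings F) X) :
  K ⊑ N <-> code_le [::] (cluster_code K) (cluster_code N).
Proof. by rewrite cleE hom_addr_id. Qed.

Lemma cluster_code_inj (X : augment T) : injective (@cluster_code X).
Proof.
move=> K N KN; have le k : code_le [::] k k by split=> //=; case: (k.2) => // b; apply: prefix_refl.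
by apply: cle_anti; apply/cle_idE; rewrite KN.
Qed.

(** A sigma type, obtained with [cid], because the lattice operations and the images have to be
    functions with values in clusters. *)
Lemma cluster_of_code (X : augment T) (k : code) : code_of X k ->
  {K : cl (marked_prunings F) X | cluster_code K = k}.
Proof.
move=> /cospan_of_code/cid[c <-]; exists (\pi_{eq_quot (cospan_equiv F X)}%qT c).
have ic := repr_cospan_iso c.
by rewrite /cluster_code -lock; apply: code_le_anti; rewrite -(hom_addr_id X);
  apply/cospan_le_code/cospan_iso_le => //;
  apply: cospan_iso_sym.
Qed.

Lemma cle_zero (Y : augment T) (f : hom (None : augment T) Y) (K : cl (marked_prunings F) None)
    (N : cl (marked_prunings F) Y) : K ⊑[f] N.
Proof. by apply/cleE; rewrite (code_of_zero (cluster_codeP K)). Qed.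

End Matchings.

(** * The bounded lattice structure on the fibres, direct and inverse images *)

Section OreanForm.
Variables (L : Type) (ar : L -> nat) (T : category) (F : cat_iso T (tree_cat ar)).

Local Notation some A := (Some A : Ob (augment T)).
Local Notation G := (marked_prunings F).

Definition bot_code (X : augment T) : code := (obj_node F X, None).

(** Over a tree, everything is cut and the one remaining leaf is marked. Over [0] the fibre has a
    single element. *)
Definition top_code (X : augment T) : code :=
  if X is Some _ then (xpred0, Some [::]) else (xpredT, None).

Definition meet_code (k n : code) : code :=
  (fun c => k.1 c || n.1 c, mark_meet k.2 n.2).

(** Addresses beyond the joined mark have to go: the mark of an upper bound is a prefix of the
    joined mark and lies outside a prefix-closed set, so nothing beyond it can be a node of the
    bound. *)
Definition join_node (k n : code) : pred (seq nat) :=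
  fun c => [&& k.1 c, n.1 c & if mark_join k.2 n.2 is Some b then ~~ prefix b c else true].

Definition join_code (k n : code) : code :=
  (join_node k n, omap (exit_prefix (join_node k n)) (mark_join k.2 n.2)).

(** Nodes of [Y] away from the occurrence are all kept; below it, those that survive in [k] are. *)
Definition dir_node (X Y : augment T) (f : hom X Y) (k : code) : pred (seq nat) :=
  fun c => obj_node F Y c &&
    (prefix (hom_addr F f) c ==> k.1 (drop (size (hom_addr F f)) c)).

(** The occurrence may show only a pruning of [X] inside [Y], so the translated mark can point past
    an empty leaf; it is retracted to the first address outside the node set. *)
Definition dir_code (X Y : augment T) (f : hom X Y) (k : code) : code :=
  (dir_node f k, omap (fun b => exit_prefix (dir_node f k) (hom_addr F f ++ b)) k.2).

Definition inv_code (X Y : augment T) (f : hom X Y) (n : code) : code :=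
  if X is Some _ then (fun c => n.1 (hom_addr F f ++ c), mark_res (hom_addr F f) n.2)
  else (xpredT, None).

Lemma prefix_closedP P a b : prefix_closed P -> prefix a b -> P b -> P a.
Proof. by move=> clP /prefixP[c ->]; apply: clP. Qed.

Lemma exitsN P b : exits P b -> ~~ P b.
Proof. by move=> /(_ b (prefix_refl _)) ->; rewrite eqxx. Qed.

Lemma bot_codeP X : code_of F X (bot_code X).
Proof. by split=> //; [exact: obj_node_closed|move=> ->]. Qed.

Lemma top_codeP X : code_of F X (top_code X).
Proof.
case: X => [A|]; split=> //= b [<-]; split; first by case: (F A : tree ar).
by move=> c; rewrite prefixs0 => /eqP ->.
Qed.

Lemma mark_meetP s t b : mark_meet s t = Some b ->
  (s = Some b /\ exists2 c, t = Some c & prefix c b) \/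
  (t = Some b /\ exists2 c, s = Some c & prefix c b).
Proof.
case: s t => [d|] [c|] //=; case: ifPn => [dc [<-]|_]; first by right; split=> //; exists d.
by case: ifPn => // cd [<-]; left; split=> //; exists c.
Qed.

Lemma meet_codeP X k n : code_of F X k -> code_of F X n -> code_of F X (meet_code k n).
Proof.
move=> [kX kcl km k0] [nX ncl nm n0]; split=> /=.
- by move=> a /orP[/kX|/nX].
- by move=> a b /orP[/kcl ->|/ncl ->]; rewrite ?orbT.
(* [R] already stops at the prefix [c] of [b], so it does not contain [b], and [b] stays the exit of
   the union. *)
- have exits_or P R b c : prefix_closed R -> exits P b -> exits R c -> prefix c b ->
      exits (fun d => P d || R d) b.
    move=> Rcl eb ec cb d db; rewrite (eb d db).
    case: eqVneq => //= ->; apply/negbTE; apply: contra (exitsN ec).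
    exact: prefix_closedP.
  move=> b /mark_meetP[] [/[dup] sb].
    by move=> /km[fb eb] [c /nm[fc ec] cb]; split=> //; apply: exits_or cb.
  move=> /nm[fb eb] [c /km[fc ec] cb]; split=> //.
  by rewrite (_ : (fun _ => _) = (fun d => n.1 d || k.1 d)); [exact: exits_or cb|
    apply/funext => d; rewrite orbC].
- by move=> X0 a; rewrite k0.
Qed.

Lemma join_node_mark k n m : mark_join k.2 n.2 = Some m -> ~~ join_node k n m.
Proof. by rewrite /join_node => ->; rewrite prefix_refl !andbF. Qed.

Lemma mark_join_prefix s t m : mark_join s t = Some m ->
  exists2 b, s = Some b \/ t = Some b & prefix m b.
Proof.
case: s t => [b|] [c|] //= [<-].
- by exists b; [left|have := prefix_refl (lcp b c); rewrite prefix_lcp => /andP[]].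
- by exists b; [left|apply: prefix_refl].
- by exists c; [right|apply: prefix_refl].
Qed.

Lemma join_codeP X k n : code_of F X k -> code_of F X n -> code_of F X (join_code k n).
Proof.
move=> [kX kcl km k0] [nX ncl nm n0]; split=> /=.
- by move=> a /and3P[/kX].
- move=> a b; rewrite /join_node => /and3P[/kcl -> /ncl -> /=].
  case: mark_join => // c; apply: contra => ca.
  exact: prefix_trans ca (prefix_prefix _ _).
- move=> b; case mE: (mark_join k.2 n.2) => [m|] //= [<-]; split; last first.
    by apply: exit_prefixP; apply: join_node_mark.
  apply: obj_fits_prefix (exit_prefix_prefix _ _) _.
  by have [d [/km[]|/nm[]] fd _ md] := mark_join_prefix mE; apply: obj_fits_prefix md fd.
- move=> X0 a; rewrite /join_node k0 // n0 //=.
  case mE: mark_join => [m|] //.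
  by have [d [/km[]|/nm[]]] := mark_join_prefix mE; rewrite X0.
Qed.

Lemma dir_codeP (X Y : augment T) (f : hom X Y) k :
  code_of F X k -> code_of F Y (dir_code f k).
Proof.
move=> [kX kcl km k0]; split=> /=.
- by move=> a /andP[].
- move=> a b /andP[/obj_node_closed Ya /implyP h]; rewrite /dir_node Ya /=.
  apply/implyP => /prefixP[c ca]; move: h; rewrite ca -catA prefix_prefix !drop_size_cat //.
  by move=> /(_ isT); apply: kcl.
- case: k kX kcl km k0 => P [b|] //= kX kcl km k0 _ [<-].
  have [fb eb] := km b erefl; split; last first.
    apply: exit_prefixP; rewrite /dir_node prefix_prefix drop_size_cat //=.
    by rewrite (negPf (exitsN eb)) andbF.
  apply: obj_fits_prefix (exit_prefix_prefix _ _) _.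
  case: X Y f fb {kX km k0} => [A|] [B|] // f /= fb.
  have [S AS BS] := hom_addrP F f; rewrite (subtree_fits _ AS); exact: prunes_fits BS fb.
- move=> Y0; subst Y; case: X f kX k0 {km} => [A|] f kX k0; first by case: f.
  by move=> a; rewrite /dir_node /= k0 // implybT.
Qed.

Lemma inv_codeP (X Y : augment T) (f : hom X Y) n :
  code_of F Y n -> code_of F X (inv_code f n).
Proof.
case: X f => [A|] f; last by move=> _; split.
move=> [nY ncl nm _]; split=> //= [a /nY/obj_node_addr //|a b|].
  by rewrite catA; apply: ncl.
case: Y f nY nm => [B|] f nY nm; last by case: f.
have [S Bf AS] := hom_addrP F f; set a := hom_addr F f in Bf *.
case: n nY ncl nm => R [t|] //= nY ncl nm b.
have [ft et] := nm t erefl.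
(* If the mark is at or above the occurrence, no node of [R] lies below [a], so the root of [X]
   becomes an empty leaf and takes the mark. *)
case: ifPn => [ta [<-]|nta].
  split; first by case: (F A : tree ar).
  move=> c; rewrite prefixs0 => /eqP ->; rewrite cats0 eqxx; apply/negbTE.
  by apply: contra (exitsN et); apply: prefix_closedP ncl ta.
case: ifP => // /prefixP[d td] [<-]; rewrite td drop_size_cat //.
have ed : exits (fun c => R (a ++ c)) d.
  by move=> c cd; rewrite et td ?prefix_cat2l // eqseq_cat // eqxx.
split=> //.
have fd : fits S d by rewrite -(subtree_fits d Bf) -td.
(* The word [d] is known to fit [S]. Its proper prefixes lead to nodes in [R], hence to nodes of
   [S], so it also fits [X]. *)
apply: fits_of_prunes AS _ fd => c cd cneq.
rewrite -(subtree_isnode c Bf); apply: (nY (a ++ c)).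
by rewrite et td ?prefix_cat2l // eqseq_cat // eqxx.
Qed.

Definition code_cluster X k (kP : code_of F X k) : cl G X :=
  sval (cluster_of_code kP).

Lemma code_clusterK X k (kP : code_of F X k) : cluster_code (code_cluster kP) = k.
Proof. exact: svalP (cluster_of_code kP). Qed.

Local Notation cod K := (cluster_code K).
Local Notation codP K := (cluster_codeP K).

Definition cluster_bot X : cl G X := code_cluster (bot_codeP X).
Definition cluster_top X : cl G X := code_cluster (top_codeP X).
Definition cluster_meet X (K N : cl G X) : cl G X := code_cluster (meet_codeP (codP K) (codP N)).
Definition cluster_join X (K N : cl G X) : cl G X := code_cluster (join_codeP (codP K) (codP N)).
Definition cluster_dir (X Y : augment T) (f : hom X Y) (K : cl G X) : cl G Y :=
  code_cluster (dir_codeP f (codP K)).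
Definition cluster_inv (X Y : augment T) (f : hom X Y) (N : cl G Y) : cl G X :=
  code_cluster (inv_codeP f (codP N)).

Lemma cluster_botP X (K : cl G X) : cluster_bot X ⊑ K.
Proof. by apply/cle_idE; rewrite code_clusterK; split=> //; apply: code_node (codP K). Qed.

Lemma cluster_topP X (K : cl G X) : K ⊑ cluster_top X.
Proof.
case: X K => [A|] K; last exact: cle_zero.
by apply/cle_idE; rewrite code_clusterK; split=> //=;
  case: ((cod K).2) => // b; rewrite /= prefix0s.
Qed.

Lemma cluster_meetP X (K M N : cl G X) : K ⊑ cluster_meet M N <-> K ⊑ M /\ K ⊑ N.
Proof.
rewrite !cle_idE code_clusterK /code_le /= mark_le_meet; split.
  by move=> [h /andP[-> ->]]; split; split=> // c hc; apply: h; rewrite hc ?orbT.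
by move=> [[h ->] [h' ->]]; split=> // c /orP[/h|/h'].
Qed.

(** Shows that the retracted mark of a join or direct image still extends the mark of every upper
    bound. *)
Lemma exits_mono P R b m : prefix_closed R -> exits R b -> prefix b m ->
  (forall c, R c -> P c) -> prefix b (exit_prefix P m).
Proof.
move=> Rcl eb bm RP; apply: exit_prefix_max bm _ => c cb cneq.
by apply: RP; rewrite eb.
Qed.

Lemma cluster_joinP X (K M N : cl G X) : cluster_join K M ⊑ N <-> K ⊑ N /\ M ⊑ N.
Proof.
rewrite !cle_idE code_clusterK /code_le /=.
have [_ Ncl Nm _] := codP N.
split.
  move=> [h hm]; suff: mark_le [::] (mark_join (cod K).2 (cod M).2) (cod N).2.
    by rewrite mark_le_join => /andP[-> ->]; split; split=> // c /h/and3P[].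
  move: hm; case: (mark_join _ _) => [m|] //=; case: ((cod N).2) => // t tm.
  exact: prefix_trans tm (exit_prefix_prefix _ _).
move=> [[hK sK] [hM sM]].
have : mark_le [::] (mark_join (cod K).2 (cod M).2) (cod N).2 by rewrite mark_le_join sK sM.
have hKM : forall c, (cod N).1 c -> join_node (cod K) (cod M) c.
  move=> c Nc; apply/and3P; split; [exact: hK|exact: hM|].
  have := mark_le_join (cod K).2 (cod M).2 (cod N).2; rewrite sK sM /=.
  case: (mark_join _ _) => [m|] //; case tE: ((cod N).2) => [t|] //= tm.
  have [_ /exitsN Nt] := Nm t tE; apply: contra Nt => mc.
  exact: prefix_closedP Ncl (prefix_trans tm mc) Nc.
case: (mark_join _ _) => [m|] //=; case tE: ((cod N).2) => [t|] //= tm.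
by split=> //; have [_ et] := Nm t tE; apply: exits_mono et tm hKM.
Qed.

Lemma cluster_dirP X Y (f : hom X Y) (K : cl G X) (N : cl G Y) : cluster_dir f K ⊑ N <-> K ⊑[f] N.
Proof.
rewrite cle_idE cleE code_clusterK /code_le /=.
have [Nn Ncl Nm _] := codP N; set a := hom_addr F f.
split=> [] [h hm].
  split=> [c /h/andP[_]|]; first by rewrite prefix_prefix drop_size_cat.
  move: hm; case: ((cod K).2) => [b|] //=; case: ((cod N).2) => // t tm.
  exact: prefix_trans tm (exit_prefix_prefix _ _).
have hd : forall c, (cod N).1 c -> dir_node f (cod K) c.
  move=> c Nc; rewrite /dir_node (Nn _ Nc) /=; apply/implyP => /prefixP[d cd].
  by rewrite cd drop_size_cat //; apply: h; rewrite -cd.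
split=> //; move: hm; case: ((cod K).2) => [b|] //=; case tE: ((cod N).2) => [t|] // tm.
by have [_ et] := Nm t tE; apply: exits_mono et tm hd.
Qed.

Lemma cluster_invP X Y (f : hom X Y) (K : cl G X) (N : cl G Y) : K ⊑[f] N <-> K ⊑ cluster_inv f N.
Proof.
case: X f K => [A|] f K; last by split=> _; apply: cle_zero.
by rewrite cle_idE cleE code_clusterK /code_le /= mark_le_res.
Qed.

Lemma cle_eq X (K M : cl G X) : (forall N, K ⊑ N <-> M ⊑ N) -> K = M.
Proof. by move=> KM; apply: cle_anti; apply/KM; apply: cle_refl. Qed.

Lemma cle_eqr X (K M : cl G X) : (forall N, N ⊑ K <-> N ⊑ M) -> K = M.
Proof. by move=> KM; apply: cle_anti; apply/KM; apply: cle_refl. Qed.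

Lemma cluster_dir_id X (K : cl G X) : cluster_dir (idm X) K = K.
Proof. by apply: cle_eq => N; rewrite cluster_dirP. Qed.

Lemma cluster_inv_id X (K : cl G X) : cluster_inv (idm X) K = K.
Proof. by apply: cle_eqr => N; rewrite -cluster_invP. Qed.

(** Functoriality of both images reduces to this. The difficulty is that the address of a composite
    is [a ++ clip S b], which may be shorter than [a ++ b]. *)
Lemma cle_compE X Y Z (g : hom Y Z) (f : hom X Y) (K : cl G X) (N : cl G Z) :
  K ⊑[g ∘ f] N <-> K ⊑[f] cluster_inv g N.
Proof.
split; last first.
  by move=> KN; apply: cle_trans KN _; apply/cluster_invP; apply: cle_refl.
case: X f K => [A|] f K; last by move=> _; apply: cle_zero.
case: Y f g => [B|] f g //; case: Z g N => [C|] g N //.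
have [S CS BS] := hom_addrP F g; rewrite !cleE code_clusterK.
rewrite (hom_addr_comp _ CS) /code_le /= -mark_le_cat; have [S' BS' _] := hom_addrP F f.
have fits_f : fits S (hom_addr F f).
  apply: prunes_fits BS _.
  by rewrite -[hom_addr F f]cats0 (subtree_fits _ BS'); case: (S').
set a := hom_addr F g in CS *.
set b := hom_addr F f in fits_f *.
have [Nn Ncl Nm _] := codP N.
have [->|cneq] := eqVneq (clip S b) b; first by move=> [h hm]; split=> // c; rewrite catA; apply: h.
(* Here [b] runs through an empty leaf of [S], so [N] has no node at or beyond [a ++ b]. *)
move=> [h hm]; split=> [c|].
  rewrite catA => /Ncl/Nn; rewrite /= (subtree_isnode _ CS) => Sb.
  by case/eqP: cneq; apply: clip_id; move: Sb; rewrite /isnode /position; case: subtree.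
have Sclip : ~~ (cod N).1 (a ++ clip S b).
  apply: contra cneq => /Nn; rewrite /= (subtree_isnode _ CS) => ?.
  by apply/eqP/clip_isnode.
case: ((cod K).2) hm => [d|] //=; case tE: ((cod N).2) => [t|] //= tp.
have [_ et] := Nm t tE.
(* The mark [t] is comparable with [a ++ clip S b], which is not a node of [N]. All proper prefixes
   of [t] are nodes, so [t] cannot reach strictly beyond it. *)
suff tc : prefix t (a ++ clip S b).
  apply: prefix_trans tc _; rewrite -catA prefix_cat2l.
  exact: prefix_trans (clip_prefix S b) (prefix_prefix _ _).
have /orP[//|ct] := prefix_comparable tp (prefix_prefix (a ++ clip S b) d).
by move: Sclip; rewrite (et _ ct) negbK => /eqP ->; apply: prefix_refl.
Qed.

Lemma cluster_dir_comp X Y Z (g : hom Y Z) (f : hom X Y) (K : cl G X) :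
  cluster_dir (g ∘ f) K = cluster_dir g (cluster_dir f K).
Proof. by apply: cle_eq => N; rewrite !cluster_dirP cle_compE (cluster_invP g) cluster_dirP. Qed.

Lemma cluster_inv_comp X Y Z (g : hom Y Z) (f : hom X Y) (N : cl G Z) :
  cluster_inv (g ∘ f) N = cluster_inv f (cluster_inv g N).
Proof. by apply: cle_eqr => K; rewrite -!cluster_invP -cle_compE. Qed.

Definition marked_prunings_orean : orean G :=
  Orean cluster_botP cluster_topP cluster_meetP cluster_joinP cluster_dirP cluster_invP
    cluster_dir_id cluster_dir_comp cluster_inv_id cluster_inv_comp.

End OreanForm.

(** * Factorization, universal maps and the noetherian axioms *)

Section Decomposition.
Variables (L : Type) (ar : L -> nat) (T : category) (F : cat_iso T (tree_cat ar)).

Local Notation some A := (Some A : Ob (augment T)).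
Local Notation none := (None : Ob (augment T)).
Local Notation G := (marked_prunings F).
Local Notation O := (marked_prunings_orean F).
Local Notation cod K := (cluster_code K).
Local Notation addr f := (hom_addr F f).

Lemma hom_addr_compE (A B C : T) (m : hom (some B) (some C)) (q : hom (some A) (some B)) :
  classE F q -> addr (m ∘ q) = addr m.
Proof.
by move=> /classE_addr q0; have [S BS _] := hom_addrP F m; rewrite (hom_addr_comp _ BS) q0 cats0.
Qed.

Lemma hom_addr_compM (A B C : T) (m : hom (some B) (some C)) (f : hom (some A) (some B)) :
  classM F m -> addr (m ∘ f) = addr m ++ addr f.
Proof.
move=> /classM_addr mB; rewrite (hom_addr_comp _ mB) clip_id // /position.
by have [S -> _] := hom_addrP F f.
Qed.

Lemma meetE X (K M : cl G X) : cod (meet O K M) = meet_code (cod K) (cod M).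
Proof. exact: code_clusterK. Qed.

Lemma joinE X (K M : cl G X) : cod (join O K M) = join_code (cod K) (cod M).
Proof. exact: code_clusterK. Qed.

Lemma dirE X Y (f : hom X Y) (K : cl G X) : cod (dir O f K) = dir_code F f (cod K).
Proof. exact: code_clusterK. Qed.

Lemma invE X Y (f : hom X Y) (N : cl G Y) : cod (inv O f N) = inv_code F f (cod N).
Proof. exact: code_clusterK. Qed.

Lemma KerE X Y (f : hom X Y) : cod (Ker O f) = inv_code F f (bot_code F Y).
Proof. by rewrite /Ker /= !code_clusterK. Qed.

Lemma ImE X Y (f : hom X Y) : cod (Im O f) = dir_code F f (top_code X).
Proof. by rewrite /Im /= !code_clusterK. Qed.

(** No retraction takes place, because the proper prefixes of the address of an occurrence are nodes
    of [Y]. *)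
Lemma Im_mark (A : T) Y (f : hom (some A) Y) : (cod (Im O f)).2 = Some (addr f).
Proof.
rewrite ImE /= cats0; congr Some; apply: prefix_anti; first exact: exit_prefix_prefix.
apply: exit_prefix_max (prefix_refl _) _ => c cf cneq.
rewrite /dir_node /= (hom_addr_node cf cneq) /=; apply/implyP => fc.
by rewrite (prefix_anti cf fc) eqxx in cneq.
Qed.

Lemma Im_node (A : T) Y (f : hom (some A) Y) c :
  (cod (Im O f)).1 c = obj_node F Y c && ~~ prefix (addr f) c.
Proof. by rewrite ImE /= /dir_node /= implybF. Qed.

(** Between trees, comparing kernels says that the nodes of the subtree hit by [f] are nodes of [Q].
    That subtree is thus a pruning of [Q], and the factor has the same address as [f]. *)
Lemma classE_universal X Q (q : hom X Q) : classE F q -> universal_quotient_of O (Ker O q) q.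
Proof.
move=> qE; split=> [|Y f Kf]; first exact: cle_refl.
suff [g gq] : exists g : hom Q Y, g ∘ q = f.
  by exists g; split=> // g' gq'; apply: (classE_epi qE); rewrite gq gq'.
case: X Q q qE f Kf => [A|] [B|] q qE // f Kf; last by exists f; case: Y f {Kf} => [?|] [].
case: Y f Kf => [C|] // f Kf.
have q0 : addr q = [::] by apply/classE_addr.
have [S CS AS] := hom_addrP F f.
have [|g gf] := @hom_of_addr _ _ _ F B C _ S CS.
  apply: prunes_of_isnode (classE_prunes qE) AS _ => c Sc.
  have /cleE := iffRL (invP O f _ _) Kf; rewrite KerE code_clusterK /code_le /= => -[/(_ c) + _].
  by rewrite q0 (subtree_isnode _ CS); apply.
by exists g; apply: (@hom_addr_inj _ _ _ F); rewrite hom_addr_compE.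
Qed.

(** Between trees, comparing the marks of the images makes the address of [m] a prefix of that of
    [f], and the remaining word is the address of the factor. If [m] starts at [0], its image has no
    mark, so only maps out of [0] have an image below it. *)
Lemma classM_universal A Y (m : hom A Y) : classM F m -> universal_embedding_of O (Im O m) m.
Proof.
move=> mM; split=> [|X f]; first exact: cle_refl.
case: A m mM => [A|] m mM; last first.
  case: X f => [B|] f.
    by move/cle_idE => [_]; rewrite Im_mark ImE.
  by move=> _; exists tt; split=> [|[]] //; case: Y m mM f => [?|] [] _ [].
case: X f => [B|] f; last first.
  by move=> _; exists tt; split=> [|[]] //; case: Y m mM f => [?|] ? ? [].
move=> /cle_idE[_]; rewrite !Im_mark /mark_le cat0s.
case: Y m mM f => [C|] // m mM f mf.
have [S CS BS] := hom_addrP F f; have mA := iffLR (classM_addr F m) mM.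
have [e fe] := prefixP mf.
have [|g ge] := @hom_of_addr _ _ _ F B A e S _ BS.
  by move: CS; rewrite fe subtree_cat mA.
exists g; split=> [|g' mg'].
  by apply: (@hom_addr_inj _ _ _ F); rewrite hom_addr_compM // ge.
apply: (@hom_addr_inj _ _ _ F).
move: fe; rewrite -mg' hom_addr_compM // => /eqP.
by rewrite eqseq_cat // eqxx ge => /eqP ->.
Qed.

Lemma factorization X Y (f : hom X Y) : exists (Q : augment T) (q : hom X Q) (m : hom Q Y),
  [/\ f = m ∘ q, classE F q & classM F m].
Proof.
case: X f => [A|] f; last first.
  by exists none, (tt : hom none none), f; split=> //; case: Y f => [?|] [].
case: Y f => [C|] // f; have [S CS AS] := hom_addrP F f.
have [B BS] := obj_of_tree F S.
have [|q q0] := @hom_of_addr _ _ _ F A B [::] S _ AS; first by rewrite BS.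
have [|m mf] := @hom_of_addr _ _ _ F B C _ S CS; first by rewrite BS; apply: prunes_refl.
have qE : classE F q by apply/classE_addr.
exists (some B), q, m; split=> //; last by apply/classM_addr; rewrite mf CS BS.
by apply: (@hom_addr_inj _ _ _ F); rewrite hom_addr_compE.
Qed.

(** The kernel of an occurrence is the bottom, since the subtree at its address is the whole
    domain. *)
Lemma Ker_comp X Q Y (m : hom Q Y) (q : hom X Q) : classM F m -> Ker O (m ∘ q) = Ker O q.
Proof.
move=> mM; rewrite /Ker (@inv_comp _ _ O); congr (inv O q _).
apply: cle_anti; last exact: botP.
case: Q m mM {q} => [B|] m mM; last exact: cle_zero.
case: Y m mM => [C|] // m mM; apply/cle_idE; rewrite !code_clusterK.
split=> //= c; have /classM_addr CB := mM.
by rewrite (subtree_isnode _ CB).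
Qed.

(** The image of a pruning is the top, since its mark is at the root. *)
Lemma Im_comp X Q Y (m : hom Q Y) (q : hom X Q) : classE F q -> Im O (m ∘ q) = Im O m.
Proof.
move=> qE; rewrite /Im (@dir_comp _ _ O); congr (dir O m _).
apply: cle_anti; first exact: topP.
case: Q q qE {m} => [B|] q qE; last exact: cle_zero.
case: X q qE => [A|] // q qE; apply/cle_idE.
have := Im_mark q; have q0 : addr q = [::] by apply/classE_addr.
rewrite /Im /= q0 => qm; split=> [c|]; last by rewrite qm code_clusterK.
have := Im_node q c; rewrite /Im /= q0 prefix0s andbF => ->.
by [].
Qed.

(** One inequality is formal. For the other, the retraction of the translated mark must not stop
    before the translate of the mark of the join. *)
Lemma inv_dir_join X Y (f : hom X Y) (K : cl G X) :
  inv O f (dir O f K) = join O K (Ker O f).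
Proof.
apply: cle_anti; last first.
  apply/joinP; split; first by apply/(iffLR (invP O f _ _))/(iffLR (dirP O f _ _))/cle_refl.
  have fb : Ker O f ⊑[f] bot O Y by apply/(iffRL (invP O f _ _))/cle_refl.
  by have := cle_trans fb (botP O (dir O f K)); rewrite comp1m => /(iffLR (invP O f _ _)).
(* The explicit join is replaced by an arbitrary upper bound [M] of [K] and [Ker f], which is all
   that the argument uses. *)
have [KJ JK] := iffLR (@joinP _ _ O _ _ _ _) (cle_refl (join O K (Ker O f))).
move: (join _ _ _) KJ JK => M KM fM.
case: X f K M KM fM => [A|] f K M KM fM; last exact: cle_zero.
case: Y f fM => [B|] // f fM.
have [S BS AS] := hom_addrP F f.
move: KM fM => /cle_idE[KMn KMm] /cle_idE; rewrite KerE => -[/= fMn _].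
have dM c : (cod M).1 c -> dir_node F f (cod K) (addr f ++ c).
  move=> Mc; rewrite /dir_node /= prefix_prefix drop_size_cat //=.
  by rewrite (KMn _ Mc) andbT; apply: (fMn c Mc).
apply/cle_idE; rewrite invE dirE; split=> [c|]; first exact: dM.
rewrite /inv_code /dir_code [in X in mark_le _ X _]/=.
rewrite -/(mark_res _ _); case: ((cod K).2) KMm => [b|] //; rewrite [omap _ _]/=.
case tE: ((cod M).2) => [t|] // tb.
have [_ _ Mm _] := cluster_codeP M; have [_ et] := Mm t tE.
suff /prefixP[e ->] : prefix (addr f ++ t) (exit_prefix (dir_node F f (cod K)) (addr f ++ b)).
  by rewrite -catA mark_res_cat; apply: prefix_prefix.
apply: exit_prefix_max; first by rewrite prefix_cat2l.
move=> c ct cneq.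
(* Prefixes strictly above the occurrence are nodes of [Y]. From [addr f] downwards they are
   translates of proper prefixes of [t], which are nodes of [M]. *)
have /orP[cf|/prefixP[d cd]] := prefix_comparable ct (prefix_prefix (addr f) t).
  have [ceq|cneqf] := eqVneq c (addr f).
    have : prefix [::] t := prefix0s _.
    move/et; rewrite ceq -[X in dir_node _ _ _ X]cats0 => M0.
    apply: dM; rewrite M0; apply: contra cneq => /eqP <-; by rewrite ceq cats0.
  rewrite /dir_node (hom_addr_node cf cneqf) /=; apply/implyP => fc.
  by rewrite (prefix_anti cf fc) eqxx in cneqf.
rewrite cd; apply: dM; move: ct cneq; rewrite cd prefix_cat2l => dt.
by rewrite (et d dt) eqseq_cat // eqxx.
Qed.

(** One inequality is formal. For the other, [mark_meet_res] identifies the mark of the meet with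
    the translated mark before retraction, and retraction only shortens a mark, which enlarges the
    cluster. *)
Lemma dir_inv_meet X Y (f : hom X Y) (N : cl G Y) :
  dir O f (inv O f N) = meet O N (Im O f).
Proof.
apply: cle_anti.
  apply/meetP; split; first by apply/(iffRL (dirP O f _ _))/(iffRL (invP O f _ _))/cle_refl.
  have ft : top O X ⊑[f] Im O f by apply/(iffLR (dirP O f _ _))/cle_refl.
  by have := cle_trans (topP O (inv O f N)) ft; rewrite compm1 => /(iffRL (dirP O f _ _)).
apply/cle_idE; rewrite meetE dirE invE; case: X f => [A|] f; last first.
  split=> /= [c|]; last by rewrite ImE /=; case: ((cod N).2).
  rewrite /dir_node => /andP[Yc _]; apply/orP; right.
  by rewrite ImE /= /dir_node Yc implybT.
split=> [c|].
  rewrite [X in _ -> X]/= Im_node /= /dir_node => /andP[->]; case: (boolP (prefix _ _)) => /=.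
    by move=> /prefixP[d ->]; rewrite drop_size_cat // => ->.
  by rewrite orbT.
rewrite [(meet_code _ _).2]/= Im_mark mark_meet_res /=.
by case: mark_res => [b|] //=; apply: exit_prefix_prefix.
Qed.

(** Inverse images of the unmarked bottom are unmarked. Conversely, an unmarked cluster over a tree
    is the kernel of the pruning that represents it. *)
Lemma normalP X (K : cl G X) : normal O K <-> (cod K).2 = None.
Proof.
split=> [[Y [f ->]]|].
  by rewrite KerE; case: X {K} f => [A|].
case: X K => [A|] K K0; last first.
  exists none, (tt : hom none none); apply: cle_anti; exact: cle_zero.
have [c cK] := cospan_of_code (cluster_codeP K).
case: c cK => -[Q|] // U q u qE uM U01 cK.
exists (some Q), q; apply: (@cluster_code_inj _ _ _ F); rewrite KerE -cK.
have q0 : addr q = [::] by apply/classE_addr.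
move: K0; rewrite -cK /cospan_code /= q0 => ->.
by congr pair; apply/funext.
Qed.

Lemma join_normal X (K M : cl G X) : normal O K -> normal O M -> normal O (join O K M).
Proof. by move=> /normalP K0 /normalP M0; apply/normalP; rewrite joinE /= K0 M0. Qed.

(** The witness is the occurrence of the subtree at [a]. *)
Lemma conormal_eq (A : T) (K : cl G (some A)) a : position (F A : tree ar) a ->
  (forall c, (cod K).1 c = isnode (F A : tree ar) c && ~~ prefix a c) ->
  (cod K).2 = Some a -> conormal O K.
Proof.
rewrite /position; case Aa: subtree => [S|] // _ Kn Km.
have [B BS] := obj_of_tree F S.
have [|f fa] := @hom_of_addr _ _ _ F B A a S Aa; first by rewrite BS; apply: prunes_refl.
exists (some B), f; apply: (@cluster_code_inj _ _ _ F).
rewrite [LHS]surjective_pairing [RHS]surjective_pairing Im_mark Km fa; congr pair.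
by apply/funext => c; rewrite Kn Im_node fa.
Qed.

(** The bottom is the image of the map from [0]. *)
Lemma conormal_bot X (K : cl G X) : cod K = bot_code F X -> conormal O K.
Proof.
move=> K0; exists none, (tt : hom none X); apply: (@cluster_code_inj _ _ _ F).
rewrite ImE K0 /dir_code /=; congr pair; apply/funext => c.
by rewrite /dir_node implybT andbT.
Qed.

Lemma conormalP (A : T) (K : cl G (some A)) : conormal O K <-> cod K = bot_code F (some A) \/
  exists a, [/\ position (F A : tree ar) a, (cod K).2 = Some a &
    forall c, (cod K).1 c = isnode (F A : tree ar) c && ~~ prefix a c].
Proof.
split; last by move=> [/conormal_bot //|[a [Aa Ka Kn]]]; apply: conormal_eq Aa Kn Ka.
move=> [[B|] [f ->]]; last first.
  left; rewrite ImE /dir_code /=; congr pair; apply/funext => c.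
  by rewrite /dir_node implybT andbT.
right; exists (addr f); rewrite Im_mark; split=> // [|c]; last by rewrite Im_node.
by have [S fS _] := hom_addrP F f; rewrite /position fS.
Qed.

(** Two cut subtrees are nested or disjoint: their meet cuts the inner one in the first case and is
    the bottom in the second. *)
Lemma meet_conormal X (K M : cl G X) : conormal O K -> conormal O M -> conormal O (meet O K M).
Proof.
case: X K M => [A|] K M; last first.
  move=> _ _; apply: conormal_bot; exact: code_of_zero (cluster_codeP _).
have meetC (K' M' : cl G (some A)) : meet O K' M' = meet O M' K'.
  by apply: cle_eqr => N; rewrite !meetP; split=> -[].
have meet_bot (K' M' : cl G (some A)) : cod K' = bot_code F (some A) -> conormal O (meet O K' M').
  move=> K0; apply: conormal_bot; rewrite -K0; congr cluster_code; apply: cle_anti.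
    by have [] := iffLR (@meetP _ _ O _ _ _ _) (cle_refl (meet O K' M')).
  by apply/cle_idE; rewrite K0; split=> //; apply: code_node (cluster_codeP _).
move=> /conormalP[K0|[a [Aa Ka Kn]]]; first by move=> _; apply: meet_bot.
move=> /conormalP[M0|[b [Ab Mb Mn]]]; first by rewrite meetC; apply: meet_bot.
have node c : (cod (meet O K M)).1 c = isnode (F A : tree ar) c && ~~ (prefix a c && prefix b c).
  by rewrite meetE /= Kn Mn -andb_orr negb_and.
have mark : (cod (meet O K M)).2 = mark_meet (Some a) (Some b) by rewrite meetE /= Ka Mb.
case: (boolP (prefix a b)) => [ab|nab].
  apply: (conormal_eq Ab); last by rewrite mark /= ab.
  move=> c; rewrite node; case: (boolP (prefix b c)); last by rewrite andbF.
  by move=> bc; rewrite (prefix_trans ab bc).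
case: (boolP (prefix b a)) => [ba|nba].
  apply: (conormal_eq Aa); last by rewrite mark /= (negPf nab) ba.
  move=> c; rewrite node; case: (boolP (prefix a c)) => //.
  by move=> ac; rewrite (prefix_trans ba ac).
apply: conormal_bot; rewrite [LHS]surjective_pairing mark /= (negPf nab) (negPf nba).
congr pair; apply/funext => c; rewrite node.
case: (boolP (prefix a c && prefix b c)) => [/andP[ac bc]|_]; last by rewrite andbT.
by have := prefix_comparable ac bc; rewrite (negPf nab) (negPf nba).
Qed.

Lemma marked_prunings_noetherian : noetherian O.
Proof.
split.
- exact: inv_dir_join.
- exact: dir_inv_meet.
- move=> X Y f; have [Q [q [m [-> qE mM]]]] := factorization f.
  exists Q, q, m; split=> //.
    by rewrite Ker_comp //; apply: classE_universal.
  by rewrite Im_comp //; apply: classM_universal.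
- exact: join_normal.
- exact: meet_conormal.
Qed.

(** * Exact join decomposition *)

Definition normal_part_code (k : code) : code := (k.1, None).

Lemma normal_part_codeP X k : code_of F X k -> code_of F X (normal_part_code k).
Proof. by move=> [kX kcl _ k0]; split. Qed.

(** Restores everything that was cut except the marked subtree; without a mark this is the bottom
    code. *)
Definition conormal_part_code X (k : code) : code :=
  (fun c => obj_node F X c && (if k.2 is Some b then ~~ prefix b c else true), k.2).

Lemma conormal_part_codeP X k : code_of F X k -> code_of F X (conormal_part_code X k).
Proof.
move=> [kX kcl km k0]; split=> /=.
- by move=> a /andP[].
- move=> a b /andP[/obj_node_closed -> /=]; case: (k.2) => // d; apply: contra => da.
  exact: prefix_trans da (prefix_prefix _ _).
- move=> b kb; have [fb eb] := km b kb; split=> // c cb; rewrite kb.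
  have [->|cneq] := eqVneq c b; first by rewrite prefix_refl andbF.
  rewrite kX ?eb //=; apply: contra cneq => bc; exact/eqP/prefix_anti.
- move=> X0 a; subst X; case kE: k.2 => [b|] //.
  by have [] := km b kE.
Qed.

Definition normal_part X (K : cl G X) : cl G X :=
  code_cluster (normal_part_codeP (cluster_codeP K)).

Definition conormal_part X (K : cl G X) : cl G X :=
  code_cluster (conormal_part_codeP (cluster_codeP K)).

Lemma normal_partE X (K : cl G X) : cod (normal_part K) = normal_part_code (cod K).
Proof. exact: code_clusterK. Qed.

Lemma conormal_partE X (K : cl G X) : cod (conormal_part K) = conormal_part_code X (cod K).
Proof. exact: code_clusterK. Qed.

Lemma normal_part_largest X (K : cl G X) : largest_below (@normal _ _ O) K (normal_part K).
Proof.
split; first by apply/normalP; rewrite normal_partE.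
  by apply/cle_idE; rewrite normal_partE.
move=> N /normalP N0 /cle_idE[NK _]; apply/cle_idE.
by rewrite normal_partE; split=> //; rewrite N0.
Qed.

Lemma conormal_part_conormal X (K : cl G X) : conormal O (conormal_part K).
Proof.
case: X K => [A|] K.
  apply/conormalP; rewrite conormal_partE /conormal_part_code.
  case KE: (cod K).2 => [b|]; [right|left].
    exists b; split=> //.
    have [Kn _ /(_ b KE)[fb eb] _] := cluster_codeP K.
    by apply: position_of_fits fb _ => c cb cneq; apply: (Kn c); rewrite eb.
  by congr pair; apply/funext => c; rewrite andbT.
by apply: conormal_bot; exact: code_of_zero (cluster_codeP _).
Qed.

Lemma conormal_part_le X (K : cl G X) : conormal_part K ⊑ K.
Proof.
have [Kn Kcl Km _] := cluster_codeP K.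
apply/cle_idE; rewrite conormal_partE; split=> /= [c Kc|]; last first.
  by case: ((cod K).2) => //= b; apply: prefix_refl.
rewrite (Kn _ Kc) /=; case KE: ((cod K).2) => [b|] //.
have [_ /exitsN Kb] := Km b KE.
by apply: contra Kb => bc; apply: prefix_closedP Kcl bc Kc.
Qed.

(** A conormal cluster below [K], if not the bottom, cuts at an address extending the mark of [K],
    so what it removes is also removed by the conormal part. *)
Lemma conormal_part_largest X (K : cl G X) : largest_below (@conormal _ _ O) K (conormal_part K).
Proof.
split; [exact: conormal_part_conormal|exact: conormal_part_le|move=> N].
case: X K N => [A|] K N; last by move=> _ _; apply: cle_zero.
move=> /conormalP[N0|[a [_ Na Nn]]] /cle_idE[NK NKm]; apply/cle_idE.
  by rewrite N0; split=> //; apply: code_node (cluster_codeP _).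
move: NKm; rewrite /code_le Na conormal_partE /=; case: ((cod K).2) => // b ba; split=> // c.
by rewrite Nn => /andP[-> /=]; apply: contra; apply: prefix_trans.
Qed.

(** The normal part supplies the pruning and the conormal part the mark; retracting the mark can
    only enlarge the join. *)
Lemma conormal_normal_join X (K : cl G X) : K = join O (conormal_part K) (normal_part K).
Proof.
apply: cle_anti; last first.
  by apply/joinP; split; [exact: conormal_part_le|case: (normal_part_largest K)].
apply/cle_idE; rewrite joinE conormal_partE normal_partE.
split=> [c /and3P[_]//|] /=.
by case: ((cod K).2) => [b|] //=; apply: exit_prefix_prefix.
Qed.

Lemma inv_normal_part X Y (f : hom X Y) (N : cl G Y) :
  inv O f (normal_part N) = normal_part (inv O f N).
Proof.
apply: (@cluster_code_inj _ _ _ F); rewrite invE !normal_partE invE.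
by case: X f => [A|].
Qed.

(** The node set of a direct image depends only on the node set of its argument, so the mark may be
    dropped before or after. *)
Lemma dir_normal_part X Y (f : hom X Y) :
  dir O f (normal_part (top O X)) = normal_part (Im O f).
Proof.
apply: (@cluster_code_inj _ _ _ F).
by rewrite dirE !normal_partE ImE code_clusterK.
Qed.

Lemma marked_prunings_exact_join : exact_join_decomposition O.
Proof.
exists normal_part, conormal_part; split.
- exact: normal_part_largest.
- exact: conormal_part_largest.
- exact: conormal_normal_join.
- exact: inv_normal_part.
- exact: dir_normal_part.
Qed.

(** * Universal quotients and universal embeddings *)

Lemma universal_quotientE X Q (q : hom X Q) : universal_quotient O q <-> classE F q.
Proof.
split; last by exists (Ker O q); apply: classE_universal.
(* In [q = m ∘ d] the pruning [d] has the kernel of [q], so it factors through [q] by some [g] with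
   [m ∘ g] the identity. The addresses of [m] and [g] then concatenate to [[::]], which puts [m],
   and with it [q], at the root. *)
move=> [K [Kq uq]]; have [R [d [m [qdm dE mM]]]] := factorization q.
have [|g [gq _]] := uq R d; first by rewrite -(Ker_comp d mM) -qdm.
have [h [_ hu]] := uq Q q Kq.
have mg : m ∘ g = idm Q.
  by rewrite -(hu (m ∘ g)) ?(hu (idm Q)) ?comp1m // -compA gq.
case: X Q R q d m g {uq h hu Kq K} qdm dE mM mg {gq} => [A|] [B|] [C|] // q d m g qdm dE mM mg.
apply/(classE_addr F q); rewrite qdm hom_addr_compE //.
move: mg => /(congr1 (@hom_addr _ _ _ F _ _)); rewrite hom_addr_compM // hom_addr_id.
by case: (addr m).
Qed.

Lemma universal_embeddingE A Y (m : hom A Y) : universal_embedding O m <-> classM F m.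
Proof.
split; last by exists (Im O m); apply: classM_universal.
(* Dually, [m = u ∘ d] gives [g] with [g ∘ d] the identity. Then [g] lies at the root, so the two
   trees are prunings of each other and coincide. *)
move=> [N [mN um]]; have [R [d [u [mud dE uM]]]] := factorization m.
have [|g [mg _]] := um R u; first by rewrite -(Im_comp u dE) -mud.
have [h [_ hu]] := um A m mN.
have gd : g ∘ d = idm A.
  by rewrite -(hu (g ∘ d)) ?(hu (idm A)) ?compm1 // compA mg.
case: A Y R m d u g {um h hu mN N} mud dE uM gd {mg} => [A|] [B|] [C|] // m d u g mud dE uM gd.
have AC := classE_prunes dE.
have g0 : addr g = [::].
  by move: gd => /(congr1 (@hom_addr _ _ _ F _ _)); rewrite hom_addr_compE // hom_addr_id.
have CA : prunes (F C : tree ar) (F A) by apply/classE_prunes/(classE_addr F g).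
apply/(classM_addr F m); rewrite mud hom_addr_compE //.
rewrite (iffLR (classM_addr F u) uM); congr Some; exact: prunes_anti.
Qed.
End Decomposition.

Theorem theorem3p7 (L : Type) (ar : L -> nat) (T : category)
    (F : cat_iso T (tree_cat ar)) :
  exists O : orean (marked_prunings F),
    noetherian O /\
    exact_join_decomposition O /\
    (forall (X Y : augment T) (f : hom X Y),
       universal_quotient O f <-> classE F f) /\
    (forall (X Y : augment T) (f : hom X Y),
       universal_embedding O f <-> classM F f).
Proof.
exists (marked_prunings_orean F); split; first exact: marked_prunings_noetherian.
split; first exact: marked_prunings_exact_join.
by split; [exact: universal_quotientE|exact: universal_embeddingE].
Qed.
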